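(* Let $(M=G/H,F)$ be a homogeneous Finsler space with origin $p$ and reductive decomposition $\mathfrak g=\mathfrak m\oplus\mathfrak h$. A vector $X\in\mathfrak g\setminus\{0\}$ is a geodesic vector if and only if $$g_{X_{\mathfrak m}}\big(X_{\mathfrak m},[X,Z]_{\mathfrak m}\big)=0\qquad\text{for all } Z\in\mathfrak g .$$
   Context: A Finsler metric on a smooth manifold $M$ is a continuous function $F:TM\to[0,\infty)$, smooth on $TM\setminus\{0\}$, positively homogeneous of degree one ($F(tu)=tF(u)$ for $t\ge 0$; not necessarily reversible), such that for every $y\in T_xM\setminus\{0\}$ the symmetric bilinear form $g_y(u,v)=\frac12\frac{\partial^2}{\partial s\partial t}F^2(x,y+su+tv)\big|_{s=t=0}$ on $T_xM$ is positive definite. Geodesics are the Finslerian (constant speed) geodesics, i.e. curves $\sigma$ with velocity $T=\dot\sigma$ satisfying $D_TT=0$ with reference vector $T$ for the Chern connection. $(M,F)$ is a connected Finsler manifold on which a connected Lie group $G$ of isometries acts transitively; $H$ is the isotropy group of a fixed point $p$ (the origin), and $M$ is identified with $G/H$. $\mathfrak g,\mathfrak h$ are the Lie algebras of $G,H$, and $\mathfrak g=\mathfrak m\oplus\mathfrak h$ is a reductive decomposition, i.e. $\mathrm{Ad}(H)\mathfrak m\subset\mathfrak m$. The subscript $\mathfrak m$ denotes projection onto $\mathfrak m$ along $\mathfrak h$. For $X\in\mathfrak g$ let $X^*_q=\frac{d}{dt}\big|_{t=0}\exp(tX)q$ be the corresponding fundamental vector field on $M$. The differential at the identity of $\pi:G\to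 G/H$ identifies $\mathfrak m$ with $T_pM$, with $d\pi(X_{\mathfrak m})=X^*_p$; via this identification the scalar product $g_{X^*_p}$ on $T_pM$ gives the scalar product $g_{X_{\mathfrak m}}$ on $\mathfrak m$. A vector $X\in\mathfrak g\setminus\{0\}$ is called a geodesic vector if $\gamma(t)=\exp(tX)(p)$ is a constant speed geodesic of $(M,F)$. *)

(* Defs.v *)
From HB Require Import structures.
From mathcomp Require Import all_boot all_order all_algebra.
From mathcomp Require Import all_classical all_reals all_analysis.

Set Implicit Arguments.
Unset Strict Implicit.
Unset Printing Implicit Defensive.

Import Order.TTheory GRing.Theory Num.Theory.
Import numFieldNormedType.Exports.

Local Open Scope classical_set_scope.
Local Open Scope ring_scope.

(* [V] is finite dimensional and [U] open wherever this is used: a map is then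
   C^(k+1) on [U] iff it is differentiable there and [x |-> 'd f x v] is C^k
   on [U] for every fixed [v]. *)
Fixpoint Ck_on (R : realType) (V W : normedModType R) (k : nat) (U : set V)
    (f : V -> W) : Prop :=
  match k with
  | 0 => forall x, U x -> {for x, continuous f}
  | k'.+1 => (forall x, U x -> differentiable f x) /\
             forall v : V, Ck_on k' U (fun x => 'd f x v)
  end.

Definition smooth_on (R : realType) (V W : normedModType R) (U : set V)
    (f : V -> W) : Prop :=
  forall k, Ck_on k U f.

(* Coordinate systems are total functions; only their values on [source], and
   those of the inverse [param] on the image of [source], are meaningful. *)
Record chart (R : realType) (n : nat) (T : topologicalType) := Chart {
  source : set T;
  coord :> T -> 'rV[R]_n;
  param : 'rV[R]_n -> T;
  source_open : open source;
  target_open : open (coord @` source);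
  coordK : forall x, source x -> param (coord x) = x;
  coord_continuous : forall x, source x -> {for x, continuous coord};
  param_continuous :
    forall u, (coord @` source) u -> {for u, continuous param}
}.

Definition target (R : realType) (n : nat) (T : topologicalType)
    (c : chart R n T) : set 'rV[R]_n :=
  c @` source c.

(* The atlas need not be maximal. *)
Record manifold (R : realType) (n : nat) := Manifold {
  points :> topologicalType;
  atlas : set (chart R n points);
  atlas_cover : forall x, exists2 c, atlas c & source c x;
  atlas_smooth : forall c c', atlas c -> atlas c' ->
    smooth_on (c @` (source c `&` source c')) (c' \o param c);
  manifold_hausdorff : hausdorff_space points;
  manifold_second_countable : @second_countable points
}.

Section Manifolds.
Context {R : realType}.

Definition smooth_map (m n : nat) (M : manifold R m) (N : manifold R n)
    (f : M -> N) : Prop :=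
  continuous f /\
  forall c c', atlas c -> atlas c' ->
    smooth_on (c @` (source c `&` f @^-1` source c')) (c' \o f \o param c).

(* Smoothness of a map defined on the product manifold of [M] and [N]. *)
Definition smooth_map2 (m n l : nat) (M : manifold R m) (N : manifold R n)
    (P : manifold R l) (f : M -> N -> P) : Prop :=
  continuous (fun z : M * N => f z.1 z.2) /\
  forall c c' c'', atlas c -> atlas c' -> atlas c'' ->
    smooth_on
      [set u : 'rV[R]_m * 'rV[R]_n | [/\ target c u.1, target c' u.2 &
         source c'' (f (param c u.1) (param c' u.2))]]
      (fun u => c'' (f (param c u.1) (param c' u.2))).

Definition smooth_curve (n : nat) (M : manifold R n) (s : R -> M) : Prop :=
  continuous s /\
  forall c, atlas c -> smooth_on (V := R^o) (s @^-1` source c) (c \o s).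

Definition chart_at (n : nat) (M : manifold R n) (x : M) : chart R n M :=
  s2val (cid2 (atlas_cover x)).

(* A tangent vector at [x] is represented by its components in the preferred
   chart [chart_at x].  The point only fixes the meaning of the components:
   tangent spaces at provably equal points, such as [a * 1] and [a], are
   freely identified below. *)
Definition tangent (n : nat) (M : manifold R n) (x : M) := 'rV[R]_n.

Definition tangent_map (m n : nat) (M : manifold R m) (N : manifold R n)
    (f : M -> N) (x : M) (v : tangent x) : tangent (f x) :=
  'd (chart_at (f x) \o f \o param (chart_at x)) (chart_at x x) v.

(* Components in the chart [c] of a tangent vector at [x]. *)
Definition to_coord (n : nat) (M : manifold R n) (c : chart R n M) (x : M)
    (v : tangent x) : 'rV[R]_n :=
  'd (c \o param (chart_at x)) (chart_at x x) v.

(* Tangent vector at [param c u] with components [w] in the chart [c]. *)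
Definition of_coord (n : nat) (M : manifold R n) (c : chart R n M)
    (u w : 'rV[R]_n) : tangent (param c u) :=
  'd (chart_at (param c u) \o param c) u w.

Definition field_coord (n : nat) (M : manifold R n) (c : chart R n M)
    (V : forall x : M, tangent x) (u : 'rV[R]_n) : 'rV[R]_n :=
  to_coord c (V (param c u)).

(* In coordinates [V, W] = DW(V) - DV(W). *)
Definition field_bracket (n : nat) (M : manifold R n)
    (V W : forall x : M, tangent x) (x : M) : tangent x :=
  'd (field_coord (chart_at x) W) (chart_at x x) (V x)
  - 'd (field_coord (chart_at x) V) (chart_at x x) (W x).

End Manifolds.

Section Finsler.
Context {R : realType}.

Definition metric_coord (n : nat) (M : manifold R n)
    (F : forall x : M, tangent x -> R) (c : chart R n M)
    (z : 'rV[R]_n * 'rV[R]_n) : R :=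
  F (param c z.1) (of_coord c z.1 z.2).

(* g_y(u, v).  For y = 0, where F^2 need not be twice differentiable, this
   iterated derivative still gives g_0(0, v) = 0. *)
Definition fundamental_tensor (n : nat) (M : manifold R n)
    (F : forall x : M, tangent x -> R) (x : M) (y u v : 'rV[R]_n) : R :=
  2^-1 * derive1 (V := R^o) (fun s : R =>
    derive1 (V := R^o) (fun t : R => F x (y + s *: u + t *: v) ^+ 2) 0) 0.

Record finsler (n : nat) (M : manifold R n) := Finsler {
  metric :> forall x : M, tangent x -> R;
  metric_ge0 : forall x y, 0 <= metric (x := x) y;
  metric_homogeneous : forall x (y : 'rV[R]_n) (t : R), 0 <= t ->
    metric (x := x) (t *: y) = t * metric (x := x) y;
  metric_continuous : forall c, atlas c ->
    forall z, target c z.1 -> {for z, continuous (metric_coord metric c)};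
  metric_smooth : forall c, atlas c ->
    smooth_on (W := R^o) [set z | target c z.1 /\ z.2 != 0]
      (metric_coord metric c);
  metric_convex : forall (x : M) (y u : 'rV[R]_n), y != 0 -> u != 0 ->
    0 < fundamental_tensor metric x y u u
}.

(* Coefficients of the Chern connection, following Bao-Chern-Shen, "An
   introduction to Riemann-Finsler geometry", chapter 2.  Points (x, y) of the
   tangent bundle are pairs, and [L] is the local expression of F^2. *)
Section Chern.
Context {n : nat}.
Local Notation E := ('rV[R]_n).
Variable L : E * E -> R.

Definition dx (k : 'I_n) (f : E * E -> R) (z : E * E) : R :=
  'D_((delta_mx 0 k, 0) : E * E) (f : E * E -> R^o) z.

Definition dy (k : 'I_n) (f : E * E -> R) (z : E * E) : R :=
  'D_((0, delta_mx 0 k) : E * E) (f : E * E -> R^o) z.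

Definition metric_mx (z : E * E) : 'M[R]_n :=
  \matrix_(i, j) (2^-1 * dy i (dy j L) z).

Local Notation g i j := (fun z => metric_mx z i j).
Local Notation ginv i j z := (invmx (metric_mx z) i j).

Definition cartan (i j k : 'I_n) (z : E * E) : R := 2^-1 * dy k (g i j) z.

(* gamma^i_jk *)
Definition formal_christoffel (i j k : 'I_n) (z : E * E) : R :=
  2^-1 * \sum_s ginv i s z *
    (dx k (g s j) z + dx j (g s k) z - dx s (g j k) z).

(* N^i_j = gamma^i_jk y^k - C^i_jk gamma^k_rs y^r y^s *)
Definition nonlinear_connection (i j : 'I_n) (z : E * E) : R :=
  \sum_k formal_christoffel i j k z * z.2 0 k
  - \sum_k (\sum_l ginv i l z * cartan l j k z) *
      (\sum_r \sum_s formal_christoffel k r s z * z.2 0 r * z.2 0 s).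

(* delta/delta x^k = d/dx^k - N^l_k d/dy^l *)
Definition horizontal (k : 'I_n) (f : E * E -> R) (z : E * E) : R :=
  dx k f z - \sum_l nonlinear_connection l k z * dy l f z.

Definition chern (i j k : 'I_n) (z : E * E) : R :=
  2^-1 * \sum_s ginv i s z *
    (horizontal k (g s j) z + horizontal j (g s k) z - horizontal s (g j k) z).

(* D_T W, with reference vector [T], along a curve [x] with velocity [T]. *)
Definition covariant_derivative (x T W : R -> E) (t : R) : E :=
  \row_i (derive1 W t 0 i +
          \sum_j \sum_k chern i j k (x t, T t) * W t 0 j * T t 0 k).

End Chern.

(* Constant curves are included, as geodesics of speed 0: the coefficients
   [chern] are meaningless at y = 0, but multiplied by 0 there.  As F(T) is
   constant where T <> 0, no other curve has a vanishing velocity. *)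
Definition geodesic (n : nat) (M : manifold R n) (F : finsler M) (s : R -> M)
    : Prop :=
  smooth_curve s /\
  forall c, atlas c -> forall t, source c (s t) ->
    let T := derive1 (c \o s) in
    covariant_derivative (fun z => metric_coord F c z ^+ 2) (c \o s) T T t = 0.

End Finsler.

Record lie_group (R : realType) (d : nat) := LieGroup {
  lie_manifold :> manifold R d;
  gone : lie_manifold;
  gmul : lie_manifold -> lie_manifold -> lie_manifold;
  ginv : lie_manifold -> lie_manifold;
  gmulA : associative gmul;
  gmul1 : left_id gone gmul;
  gmulV : left_inverse gone ginv gmul;
  gmul_smooth : smooth_map2 gmul;
  ginv_smooth : smooth_map ginv
}.

Section LieGroups.
Context {R : realType} {d : nat} (G : lie_group R d).

Definition lie_algebra := tangent (gone G).

Definition left_invariant_field (X : lie_algebra) (a : G) : tangent a :=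
  tangent_map (x := gone G) (gmul a) X.

Definition lie_bracket (X Y : lie_algebra) : lie_algebra :=
  field_bracket (left_invariant_field X) (left_invariant_field Y) (gone G).

Definition Ad (a : G) (X : lie_algebra) : lie_algebra :=
  tangent_map (x := gone G) (fun b : G => gmul (gmul a b) (ginv a)) X.

(* This determines [exp] uniquely: t |-> exp (tX) is the one-parameter subgroup
   with initial velocity X. *)
Definition exponential_map (exp : lie_algebra -> G) : Prop :=
  forall X : 'rV[R]_d,
    [/\ smooth_curve (fun t : R => exp (t *: X)),
        forall s t : R, exp ((s + t) *: X) = gmul (exp (s *: X)) (exp (t *: X))
      & derive1 (fun t : R => chart_at (gone G) (exp (t *: X))) 0 = X].

End LieGroups.

Record isometric_action (R : realType) (d n : nat) (G : lie_group R d)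
    (M : manifold R n) (F : finsler M) := IsometricAction {
  act :> G -> M -> M;
  act1 : forall x, act (gone G) x = x;
  actM : forall a b x, act (gmul a b) x = act a (act b x);
  act_smooth : smooth_map2 act;
  act_isometry : forall a x (v : tangent x),
    F (act a x) (tangent_map (x := x) (act a) v) = F x v
}.

Section Homogeneous.
Context {R : realType} {d n : nat} {G : lie_group R d} {M : manifold R n}
  {F : finsler M}.
Variables (a : isometric_action G F) (p : M).

(* The differential at the identity of pi : G -> G/H = M. *)
Definition dpi (X : lie_algebra G) : tangent p :=
  tangent_map (x := gone G) (fun b : G => a b p) X.

(* M = G/H as manifolds: the smooth structure of G/H is the one for which
   pi is a surjective submersion. *)
Definition homogeneous_space : Prop :=
  (forall x y, exists b, a b x = y) /\
  (forall (b : G) (v : tangent (a b p)), exists X : tangent b,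
     tangent_map (x := b) (fun b' : G => a b' p) X = v).

Definition isotropy_algebra (exp : lie_algebra G -> G) : set (lie_algebra G) :=
  [set X : 'rV[R]_d | forall t : R, a (exp (t *: X)) p = p].

Definition reductive_decomposition (exp : lie_algebra G -> G)
    (m h : {vspace 'rV[R]_d}) : Prop :=
  [/\ (forall X, X \in h <-> isotropy_algebra exp X),
      (m + h = fullv)%VS, (m :&: h = 0)%VS &
      forall b, a b p = p -> forall Y, Y \in m -> Ad b Y \in m].

(* The scalar product g_Y(U, V) on m, for Y, U, V in m. *)
Definition fundamental_tensor_m (Y U V : lie_algebra G) : R :=
  fundamental_tensor F p (dpi Y) (dpi U) (dpi V).

Definition geodesic_vector (exp : lie_algebra G -> G) (X : 'rV[R]_d) : Prop :=
  X != 0 /\ geodesic F (fun t : R => a (exp (t *: X)) p).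

End Homogeneous.

(* Main.v *)
(** Let [x(t,s) = exp(tX) b(s) p], where [b] is a curve in [G] through [1] with
    velocity [Z], and let [L = F^2].  As [exp(tX)] and [b(s)] act by isometries,
    [L(x, x_t)] at [(t,s)] equals [L(p, dpi (Ad(b(s)^-1) X))], while
    [L_y(x, x_t) . x_s] at [(t,0)] does not depend on [t].  Differentiating the
    first expression in [s], the second one in [t], and subtracting (the terms
    in [x_ts] cancel), the Euler-Lagrange expression of [L] along
    [t |-> exp(tX) p], applied to [x_s], equals
    [- L_y(p, X_m) . [X,Z]_m = - 2 g_(X_m)(X_m, [X,Z]_m)] for every [t].
    As [Z] varies, [x_s] exhausts the tangent space, and by Euler's identities
    for homogeneous functions the Euler-Lagrange expression is
    [2 g_T(D_T T, .)].  If [X_m = 0], both sides of the equivalence hold. *)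
From HB Require Import structures.
Require Import Defs.
From mathcomp Require Import all_boot all_order all_algebra.
From mathcomp Require Import all_classical all_reals all_analysis.

Set Implicit Arguments.
Unset Strict Implicit.
Unset Printing Implicit Defensive.

Import Order.TTheory GRing.Theory Num.Theory.
Import numFieldNormedType.Exports.

Local Open Scope classical_set_scope.
Local Open Scope ring_scope.

(** * Differential calculus *)

Section Differentials.
Context {R : realType}.
Implicit Types U V W : normedModType R.

(** The vertical derivative [L_y . x_s] is constant in [t] because it is the derivative at [e = 0]
    of [L(x, x_t + e x_s)], and [x_t + e x_s] at [(t,0)] is the image of [X_m + e Z_m] under the
    differential of the isometry [exp(tX)]. The bracket enters through [d/ds Ad(b(s)^-1) X = [X,Z]]
    at [s = 0]. Since [lie_bracket] is defined by left invariant fields, this is a computation with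
    second derivatives of the multiplication in the chart at the identity, and [b] is accordingly a
    straight segment of that chart. Charts have open domains and ['d] has default values, so
    smoothness and most identities concern germs: an identity that will be differentiated is proved
    on a neighbourhood. The geodesic equation is imposed in each chart; it is treated in an
    arbitrary chart at an arbitrary time, and the resulting condition depends on neither. The
    projections to [m] are absorbed by [dpi], which vanishes on [h]. As [F^2] is smooth only away
    from zero vectors, the computation assumes [X_m != 0], and the isometries carry this to all
    times. *)

Lemma near_is_diff V W (f g : V -> W) x :
  (\forall y \near x, f y = g y) -> differentiable f x -> is_diff x g ('d f x).
Proof.
move=> fg df.
have gE : g \o shift x = cst (g x) + 'd f x +o_ 0 id.
  apply/eqaddoP => e e0; have := @diff_locally _ _ _ x f df.
  move/eqaddoP => /(_ e e0) fo.
  have fg0 : \forall h \near (0 : V), f (h + x) = g (h + x).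
    by move: fg; rewrite (near_shift 0) /=; apply: filterS => h; rewrite subr0.
  near=> h.
  have -> : ((g \o shift x) - (cst (g x) + 'd f x)) h =
     ((f \o shift x) - (cst (f x) + 'd f x)) h.
    rewrite /= !fctE /= /shift (near fg0) //.
    by rewrite (nbhs_singleton fg).
  by near: h; exact: fo.
have cdf := diff_continuous df.
(* ['d g x] is a chosen value; it is pinned down by the uniqueness of the continuous linear part in
   the expansion [gE]. *)
have dgE : 'd g x = 'd f x :> (V -> W) by exact: diff_unique cdf gE.
apply: DiffDef => //.
by apply/diff_locallyP; rewrite dgE; split.
Unshelve. all: by end_near. Qed.

Lemma near_diff V W (f g : V -> W) x v :
  (\forall y \near x, f y = g y) -> differentiable f x ->
  'd g x v = 'd f x v.
Proof. by move=> fg df; have h := near_is_diff fg df; rewrite diff_val. Qed.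

Lemma near_differentiable V W (f g : V -> W) x :
  (\forall y \near x, f y = g y) -> differentiable f x -> differentiable g x.
Proof. by move=> fg df; have [] := near_is_diff fg df. Qed.

Lemma diff_comp_app U V W (f : U -> V) (g : V -> W) x v :
  differentiable f x -> differentiable g (f x) ->
  'd (fun y => g (f y)) x v = 'd g (f x) ('d f x v).
Proof. by move=> df dg; rewrite (@diff_comp _ _ _ _ f g _ df dg). Qed.

Lemma near_diff_id V (f : V -> V) x w :
  (\forall y \near x, f y = y) -> 'd f x w = w.
Proof.
move=> fE; have [di dE] := @is_diff_id R V x.
rewrite (@near_diff _ _ id f x w _ di) ?dE //.
by apply: filterS fE => y ->.
Qed.

Lemma is_diff_pair_l V W (w : W) (x : V) :
  is_diff x (fun y => (y, w)) (fun h => (h, 0)).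
Proof. exact: (is_diff_pair (is_diff_id x) (is_diff_cst w x)). Qed.

Lemma is_diff_pair_r V W (v : V) (x : W) :
  is_diff x (fun y => (v, y)) (fun h => (0, h)).
Proof. exact: (is_diff_pair (is_diff_cst v x) (is_diff_id x)). Qed.

Lemma is_diff_line V (x v : V) (t : R^o) :
  is_diff t (fun s : R^o => x + s *: v) (fun s => s *: v).
Proof.
have := @is_diffD _ _ _ _ _ _ _ t (is_diff_cst x t) (is_diff_scalel t v).
by rewrite add0r.
Qed.

Lemma fst_is_linear V W : linear (fst : (V * W)%type -> V).
Proof. by []. Qed.

Definition fst_lin V W : {linear (V * W)%type -> V} :=
  HB.pack (fst : (V * W)%type -> V)
    (GRing.isLinear.Build _ _ _ _ _ (@fst_is_linear V W)).

Lemma continuous_fst_lin V W : continuous (@fst_lin V W).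
Proof. by move=> x; exact: cvg_fst. Qed.

Lemma snd_is_linear V W : linear (snd : (V * W)%type -> W).
Proof. by []. Qed.

Definition snd_lin V W : {linear (V * W)%type -> W} :=
  HB.pack (snd : (V * W)%type -> W)
    (GRing.isLinear.Build _ _ _ _ _ (@snd_is_linear V W)).

Lemma continuous_snd_lin V W : continuous (@snd_lin V W).
Proof. by move=> x; exact: cvg_snd. Qed.

Lemma is_diff_snd V W (x : V * W) : is_diff x (@snd V W) (@snd V W).
Proof.
have cs := @continuous_snd_lin V W.
by apply: DiffDef; [exact: (linear_differentiable x cs)|exact: (diff_lin x cs)].
Qed.

(** Scaling as a bilinear map whose scalars form the normed module [R^o], so that the differential
    of a continuous bilinear map yields the product rule. *)
Definition rscale W (k : R^o) (w : W) : W := k *: w.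

Lemma scale_is_bilinear W : bilinear_for
    (GRing.Scale.Law.clone _ _ *:%R _) (GRing.Scale.Law.clone _ _ *:%R _)
    (@rscale W).
Proof.
split=> [w|k] a x y; rewrite /rscale /=.
- by rewrite scalerDl scalerA.
- by rewrite scalerDr !scalerA mulrC.
Qed.

HB.instance Definition _ W :=
  bilinear_isBilinear.Build R R^o W W _ _ (@rscale W)
    (@scale_is_bilinear W).

Lemma is_diff_scale V W (f : V -> R^o) (g : V -> W) x :
  differentiable f x -> differentiable g x ->
  is_diff x (fun y => f y *: g y) (fun v => f x *: 'd g x v + 'd f x v *: g x).
Proof.
move=> df dg; pose B := @rscale W.
have cB : continuous (fun p : R^o * W => B p.1 p.2).
  by move=> p; exact: scale_continuous.
have -> : (fun y => f y *: g y) = (fun p => B p.1 p.2) \o (fun y => (f y, g y)) by [].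
have db : differentiable (fun p : R^o * W => B p.1 p.2) (f x, g x).
  exact: differentiable_bilin.
apply: DiffDef.
  by apply: differentiable_comp; [exact: differentiable_pair|].
rewrite diff_comp //; last exact: differentiable_pair.
rewrite diff_pair // (@diff_bilin _ _ _ _ B) //.
Qed.

End Differentials.

(** * Pointwise C^k maps and their closure properties *)

Section Smoothness.
Context {R : realType}.
Implicit Types V W : normedModType R.

(** At a single point [y], [Ck_on] could involve default values of ['d] at neighbouring points where
    [f] is not differentiable; asking it for all [y] near [x] gives the usual notion. *)
Definition Ck_near V W k (f : V -> W) (x : V) := \forall y \near x, Ck_on k [set y] f.

(* The neighbourhood may depend on [k]: this is closed under composition and
   differentiation without any uniformity in [k]. *)
Definition smooth_at V W (f : V -> W) (x : V) := forall k, Ck_near k f x.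

(** Continuous coordinate forms [l i] with matching vectors [e i]. This shape passes to products and
    lets a differential in a moving direction be expanded into differentials in the fixed directions
    [e i]. *)
Definition finite_dim W := exists (k : nat) (e : 'I_k -> W)
  (l : 'I_k -> {linear W -> R^o}),
  (forall i, continuous (l i)) /\ forall w, w = \sum_i l i w *: e i.

Lemma Ck_onP V W k (U : set V) (f : V -> W) :
  Ck_on k U f <-> forall x, U x -> Ck_on k [set x] f.
Proof.
elim: k f => [|k IHk] f /=.
  by split=> h x; [move=> Ux _ ->; exact: h | move=> Ux; exact: (h x Ux)].
split=> [[df dk] x Ux|h].
  by split=> [_ ->|v]; [exact: df|exact: (IHk _).1 (dk v) x Ux].
split=> [x Ux|v]; first by have [+ _] := h x Ux; apply.
by apply/IHk => x Ux; have [_] := h x Ux; apply.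
Qed.

Lemma smooth_on_near V W (U : set V) (f : V -> W) x :
  smooth_on U f -> (\forall y \near x, U y) -> smooth_at f x.
Proof. by move=> fs Ux k; apply: filterS Ux => y; exact: (Ck_onP k U f).1 (fs k) y. Qed.

Lemma smooth_at_on V W (U : set V) (f : V -> W) :
  (forall x, U x -> smooth_at f x) -> smooth_on U f.
Proof. by move=> fs k; apply/Ck_onP => x Ux; exact: nbhs_singleton (fs x Ux k). Qed.

Lemma Ck_on1S V W k (f : V -> W) x :
  Ck_on k.+1 [set x] f <-> differentiable f x /\
    forall v, Ck_on k [set x] (fun y => 'd f y v).
Proof.
rewrite /=; split=> -[df dk]; split => //; first exact: df.
by move=> _ ->.
Qed.

Lemma Ck_on1W V W k (f : V -> W) x :
  Ck_on k.+1 [set x] f -> Ck_on k [set x] f.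
Proof.
elim: k f => [|k IHk] f /Ck_on1S[df dk].
  by move=> _ ->; exact: differentiable_continuous.
by apply/Ck_on1S; split=> // v; exact/IHk/dk.
Qed.

Lemma Ck_nearW V W k (f : V -> W) x : Ck_near k.+1 f x -> Ck_near k f x.
Proof. by apply: filterS => y; exact: Ck_on1W. Qed.

Lemma Ck_near_differentiable V W k (f : V -> W) x :
  Ck_near k.+1 f x -> \forall y \near x, differentiable f y.
Proof. by apply: filterS => y /Ck_on1S[]. Qed.

Lemma Ck_near_diff V W k (f : V -> W) v x :
  Ck_near k.+1 f x -> Ck_near k (fun y => 'd f y v) x.
Proof. by apply: filterS => y /Ck_on1S[]. Qed.

Lemma Ck_near_near V W k (f : V -> W) x :
  Ck_near k f x -> \forall y \near x, Ck_near k f y.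
Proof. exact: near_join. Qed.

Lemma Ck_near_eq1 V W k (f g : V -> W) x :
  (\forall y \near x, f y = g y) -> Ck_near k f x -> Ck_on k [set x] g.
Proof.
elim: k f g x => [|k IHk] f g x fg fk.
  move=> _ ->; have fx : f @ x --> f x := nbhs_singleton fk x erefl.
  change (g @ x --> g x); rewrite -(nbhs_singleton fg).
  by apply: cvg_trans fx; apply: near_eq_cvg; apply: filterS fg => y ->.
have df := Ck_near_differentiable fk.
apply/Ck_on1S; split; first exact: near_differentiable fg (nbhs_singleton df).
move=> v; apply: IHk (Ck_near_diff v fk).
apply: filterS2 (near_join fg) df => y fgy dfy.
by rewrite (near_diff _ fgy dfy).
Qed.

Lemma Ck_near_eq V W k (f g : V -> W) x :
  (\forall y \near x, f y = g y) -> Ck_near k f x -> Ck_near k g x.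
Proof.
move=> fg fk; apply: filterS2 (near_join fg) (Ck_near_near fk) => y.
exact: Ck_near_eq1.
Qed.

Lemma Ck_near_cst V W k (w : W) (x : V) : Ck_near k (fun=> w) x.
Proof.
apply: filterE => y; elim: k w y => [|k IHk] w y; first by move=> _ ->; exact: cst_continuous.
apply/Ck_on1S; split=> [|v]; first exact: differentiable_cst.
have -> : (fun y => 'd (fun=> w) y v) = (fun=> 0 : W).
  by apply/funext => z; rewrite (diff_cst w z).
exact: IHk.
Qed.

Lemma Ck_near_lin V W k (f : {linear V -> W}) (x : V) :
  continuous f -> Ck_near k f x.
Proof.
move=> cf; case: k => [|k]; apply: filterE => y.
  by move=> _ ->; exact: cf.
apply/Ck_on1S; split=> [|v]; first exact: linear_differentiable.
have -> : (fun y => 'd f y v) = (fun=> f v).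
  by apply/funext => z; rewrite (diff_lin z cf).
exact: nbhs_singleton (Ck_near_cst k (f v) y).
Qed.

(** The conclusion concerns the single point [x], which suits the induction on [k]; applying it at
    all nearby points then gives the version on a neighbourhood. Scaling follows the same
    pattern. *)
Lemma Ck_near_add1 V W k (f g : V -> W) (x : V) :
  Ck_near k f x -> Ck_near k g x -> Ck_on k [set x] (fun y => f y + g y).
Proof.
elim: k f g x => [|k IHk] f g x fk gk.
  move=> _ ->; apply: (@continuousD _ _ _ f g).
    exact: (nbhs_singleton fk).
  exact: (nbhs_singleton gk).
have df := Ck_near_differentiable fk.
have dg := Ck_near_differentiable gk.
apply/Ck_on1S; split.
  exact: differentiableD (nbhs_singleton df) (nbhs_singleton dg).
move=> v; apply: (@Ck_near_eq1 _ _ _ (fun y => 'd f y v + 'd g y v)).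
  apply: filterS2 df dg => y dfy dgy.
  by rewrite [X in _ = X v](diffD dfy dgy).
apply: filterS2 (Ck_near_near (Ck_near_diff v fk)) (Ck_near_near (Ck_near_diff v gk)).
by move=> y; exact: IHk.
Qed.

Lemma Ck_near_add V W k (f g : V -> W) (x : V) :
  Ck_near k f x -> Ck_near k g x -> Ck_near k (fun y => f y + g y) x.
Proof.
move=> fk gk; apply: filterS2 (Ck_near_near fk) (Ck_near_near gk) => y.
exact: Ck_near_add1.
Qed.

Lemma Ck_near_sum V W k (m : nat) (f : 'I_m -> V -> W) (x : V) :
  (forall i, Ck_near k (f i) x) -> Ck_near k (fun y => \sum_i f i y) x.
Proof.
move=> fk; elim: m f fk => [|m IHm] f fk.
  apply: Ck_near_eq (Ck_near_cst k 0 x).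
  by apply: filterE => y; rewrite big_ord0.
apply: Ck_near_eq (Ck_near_add (fk ord0) (IHm _ (fun i => fk (lift ord0 i)))).
by apply: filterE => y; rewrite big_ord_recl.
Qed.

Lemma Ck_near_scale1 V W k (f : V -> R^o) (g : V -> W) (x : V) :
  Ck_near k f x -> Ck_near k g x -> Ck_on k [set x] (fun y => f y *: g y).
Proof.
elim: k f g x => [|k IHk] f g x fk gk.
  move=> _ ->; apply: (@continuousZ _ _ _ f g).
    exact: (nbhs_singleton fk).
  exact: (nbhs_singleton gk).
have df := Ck_near_differentiable fk.
have dg := Ck_near_differentiable gk.
have [? _] := is_diff_scale (nbhs_singleton df) (nbhs_singleton dg).
apply/Ck_on1S; split => // v.
apply: (@Ck_near_eq1 _ _ _ (fun y => f y *: 'd g y v + 'd f y v *: g y)).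
  apply: filterS2 df dg => y dfy dgy.
  by have [_ ->] := is_diff_scale dfy dgy.
have near_scale (f' : V -> R^o) (g' : V -> W) :
    Ck_near k f' x -> Ck_near k g' x -> Ck_near k (fun y => f' y *: g' y) x.
  move=> fk' gk'; apply: filterS2 (Ck_near_near fk') (Ck_near_near gk') => y.
  exact: IHk.
apply: Ck_near_add; apply: near_scale.
- exact: Ck_nearW.
- exact: Ck_near_diff.
- exact: Ck_near_diff.
- exact: Ck_nearW.
Qed.

Lemma Ck_near_scale V W k (f : V -> R^o) (g : V -> W) (x : V) :
  Ck_near k f x -> Ck_near k g x -> Ck_near k (fun y => f y *: g y) x.
Proof.
move=> fk gk; apply: filterS2 (Ck_near_near fk) (Ck_near_near gk) => y.
exact: Ck_near_scale1.
Qed.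

Lemma Ck_near_continuous V W k (f : V -> W) (x : V) :
  Ck_near k f x -> {for x, continuous f}.
Proof.
elim: k => [|k IHk] fk; last exact/IHk/Ck_nearW.
exact: nbhs_singleton fk x erefl.
Qed.

Lemma Ck_near_lincomp V W W' k (l : {linear W -> W'}) (f : V -> W) (x : V) :
  continuous l -> Ck_near k f x -> Ck_near k (fun y => l (f y)) x.
Proof.
move=> cl; elim: k f x => [|k IHk] f x fk.
  apply: filterS (Ck_near_near fk) => y fy _ ->.
  exact: continuous_comp (Ck_near_continuous fy) (cl _).
apply: filterS (Ck_near_near fk) => y fy.
have df := Ck_near_differentiable fy.
apply/Ck_on1S; split.
  exact: (@differentiable_comp _ _ _ _ f l) (nbhs_singleton df) (linear_differentiable _ cl).
move=> v; apply: (@Ck_near_eq1 _ _ _ (fun z => l ('d f z v))).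
  apply: filterS df => z dfz.
  rewrite (@diff_comp _ _ _ _ f l _ dfz (linear_differentiable _ cl)).
  by rewrite (diff_lin _ cl).
exact/IHk/Ck_near_diff.
Qed.

(** [Ck_on] differentiates in fixed directions only, whereas the chain rule produces ['d g (f z)] in
    the moving direction ['d f z v]. Expanding the latter on the [e i] leaves products of C^k
    functions with fixed directions, to which the induction applies. *)
Lemma Ck_near_comp V W W' k (f : V -> W) (g : W -> W') (x : V) :
  finite_dim W ->
  Ck_near k f x -> Ck_near k g (f x) -> Ck_near k (fun y => g (f y)) x.
Proof.
move=> [d [e [l [cl le]]]].
elim: k f g x => [|k IHk] f g x fk gk.
  have cf := Ck_near_continuous fk.
  apply: filterS2 (Ck_near_near fk) (cf _ (Ck_near_near gk)) => y fy gy _ ->.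
  exact: continuous_comp (Ck_near_continuous fy) (Ck_near_continuous gy).
have cf := Ck_near_continuous fk.
apply: filterS2 (Ck_near_near fk) (cf _ (Ck_near_near gk)) => y fy gy.
have df := Ck_near_differentiable fy.
have dg := Ck_near_differentiable gy.
have {}cf := Ck_near_continuous fy.
apply/Ck_on1S; split.
  exact: (@differentiable_comp _ _ _ _ f g) (nbhs_singleton df) (nbhs_singleton dg).
move=> v; apply: (@Ck_near_eq1 _ _ _
    (fun z => \sum_i l i ('d f z v) *: 'd g (f z) (e i))).
  apply: filterS2 df (cf _ dg) => z dfz dgz.
  rewrite (@diff_comp _ _ _ _ f g _ dfz dgz) /= [in RHS](le ('d f z v)) linear_sum.
  by apply: eq_bigr => i _; rewrite linearZ.
apply: Ck_near_sum => i; apply: Ck_near_scale.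
  exact/Ck_near_lincomp/Ck_near_diff.
apply: (IHk f (fun w => 'd g w (e i))); first exact: Ck_nearW.
exact: Ck_near_diff.
Qed.

Lemma Ck_near_pair V W W' k (f : V -> W) (g : V -> W') (x : V) :
  Ck_near k f x -> Ck_near k g x -> Ck_near k (fun y => (f y, g y)) x.
Proof.
elim: k f g x => [|k IHk] f g x fk gk.
  apply: filterS2 (Ck_near_near fk) (Ck_near_near gk) => y fy gy _ ->.
  by apply: cvg_pair => /=; [exact: (Ck_near_continuous fy)|exact: (Ck_near_continuous gy)].
apply: filterS2 (Ck_near_near fk) (Ck_near_near gk) => y fy gy.
have df := Ck_near_differentiable fy.
have dg := Ck_near_differentiable gy.
apply/Ck_on1S; split.
  exact: differentiable_pair (nbhs_singleton df) (nbhs_singleton dg).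
move=> v; apply: (@Ck_near_eq1 _ _ _ (fun z => ('d f z v, 'd g z v))).
  by apply: filterS2 df dg => z dfz dgz; rewrite diff_pair.
by apply: IHk; exact: Ck_near_diff.
Qed.

Lemma finite_dim_regular : finite_dim R^o.
Proof.
exists 1%N, (fun=> 1), (fun=> idfun); split=> [_ x|w]; first exact: cvg_id.
by rewrite big_ord1 /=; rewrite -[RHS]/(w * 1) mulr1.
Qed.

Lemma finite_dim_rV n : finite_dim 'rV[R]_n.
Proof.
have lin (j : 'I_n) : linear (fun u : 'rV[R]_n => u 0 j : R^o).
  by move=> a u v; rewrite !mxE.
pose L j : {linear 'rV[R]_n -> R^o} := HB.pack (fun u : 'rV[R]_n => u 0 j : R^o)
  (GRing.isLinear.Build _ _ _ _ _ (lin j)).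
exists n, (fun j => delta_mx 0 j), L; split=> [j|w]; last exact: row_sum_delta.
exact: coord_continuous.
Qed.

Lemma finite_dim_prod W W' : finite_dim W -> finite_dim W' -> finite_dim (W * W')%type.
Proof.
move=> [m [e [l [cl le]]]] [m' [e' [l' [cl' le']]]].
pose F := @fst_lin _ W W'; pose S := @snd_lin _ W W'.
pose lF j : {linear (W * W')%type -> R^o} := GRing.Linear.clone _ _ _ _ (l j \o F) _.
pose lS j : {linear (W * W')%type -> R^o} := GRing.Linear.clone _ _ _ _ (l' j \o S) _.
exists (m + m')%N, (fun i => match fintype.split i with
  | inl i => (e i, 0) | inr i => (0, e' i) end), (fun i => match fintype.split i with
  | inl i => lF i | inr i => lS i end).
split=> [i|[w w']].
  case: fintype.split => j x.
    exact: (@continuous_comp _ _ _ fst (l j)) cvg_fst (cl j _).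
  exact: (@continuous_comp _ _ _ snd (l' j)) cvg_snd (cl' j _).
rewrite big_split_ord /=.
under eq_bigr do rewrite (unsplitK (inl _)) /=.
under [X in _ + X]eq_bigr do rewrite (unsplitK (inr _)) /=.
apply: injective_projections; rewrite /= -?[fst _]/(F _) -?[snd _]/(S _).
  rewrite !linear_sum /= [X in _ + X]big1 ?addr0 => [|i _]; last exact: scaler0.
  exact: le.
rewrite !linear_sum /= [X in X + _]big1 ?add0r => [|i _]; last exact: scaler0.
exact: le'.
Qed.

End Smoothness.

(** * Smooth germs and the scalar Schwarz theorem *)

Section SmoothAt.
Context {R : realType}.
Implicit Types V W : normedModType R.

Lemma smooth_at_eq V W (f g : V -> W) x :
  (\forall y \near x, f y = g y) -> smooth_at f x -> smooth_at g x.
Proof. by move=> fg fs k; exact: Ck_near_eq (fs k). Qed.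

Lemma smooth_at_cst V W (w : W) (x : V) : smooth_at (fun=> w) x.
Proof. by move=> k; exact: Ck_near_cst. Qed.

Lemma smooth_at_lin V W (f : {linear V -> W}) (x : V) :
  continuous f -> smooth_at f x.
Proof. by move=> cf k; exact: Ck_near_lin. Qed.

Lemma smooth_at_id V (x : V) : smooth_at (fun y : V => y) x.
Proof. by apply: (@smooth_at_lin _ _ idfun) => y; exact: cvg_id. Qed.

Lemma smooth_at_comp V W W' (f : V -> W) (g : W -> W') (x : V) :
  finite_dim W -> smooth_at f x -> smooth_at g (f x) ->
  smooth_at (fun y => g (f y)) x.
Proof. by move=> fd fs gs k; exact: Ck_near_comp fd (fs k) (gs k). Qed.

Lemma smooth_at_pair V W W' (f : V -> W) (g : V -> W') (x : V) :
  smooth_at f x -> smooth_at g x -> smooth_at (fun y => (f y, g y)) x.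
Proof. by move=> fs gs k; exact: Ck_near_pair (fs k) (gs k). Qed.

Lemma smooth_at_add V W (f g : V -> W) (x : V) :
  smooth_at f x -> smooth_at g x -> smooth_at (fun y => f y + g y) x.
Proof. by move=> fs gs k; exact: Ck_near_add (fs k) (gs k). Qed.

Lemma smooth_at_scale V W (f : V -> R^o) (g : V -> W) (x : V) :
  smooth_at f x -> smooth_at g x -> smooth_at (fun y => f y *: g y) x.
Proof. by move=> fs gs k; exact: Ck_near_scale (fs k) (gs k). Qed.

Lemma smooth_at_diff V W (f : V -> W) v (x : V) :
  smooth_at f x -> smooth_at (fun y => 'd f y v) x.
Proof. by move=> fs k; exact: Ck_near_diff (fs k.+1). Qed.

Lemma smooth_at_near_differentiable V W (f : V -> W) (x : V) :
  smooth_at f x -> \forall y \near x, differentiable f y.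
Proof. by move=> fs; exact: Ck_near_differentiable (fs 1%N). Qed.

Lemma smooth_at_differentiable V W (f : V -> W) (x : V) :
  smooth_at f x -> differentiable f x.
Proof. by move=> /smooth_at_near_differentiable /nbhs_singleton. Qed.

Lemma smooth_at_continuous V W (f : V -> W) (x : V) :
  smooth_at f x -> {for x, continuous f}.
Proof. by move=> /(_ 0%N) /Ck_near_continuous. Qed.

Lemma smooth_at_fst V W (x : V * W) : smooth_at (@fst V W) x.
Proof. exact: (smooth_at_lin (f := @fst_lin R V W) x (@continuous_fst_lin R V W)). Qed.

Lemma smooth_at_snd V W (x : V * W) : smooth_at (@snd V W) x.
Proof. exact: (smooth_at_lin (f := @snd_lin R V W) x (@continuous_snd_lin R V W)). Qed.

Lemma smooth_at_pair_l V W (w : W) (x : V) : smooth_at (fun y => (y, w)) x.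
Proof. exact: smooth_at_pair (smooth_at_id x) (smooth_at_cst w x). Qed.

Lemma smooth_at_pair_r V W (v : V) (x : W) : smooth_at (fun y => (v, y)) x.
Proof. exact: smooth_at_pair (smooth_at_cst v x) (smooth_at_id x). Qed.

Lemma smooth_at_line V (x v : V) (t : R^o) :
  smooth_at (fun s : R^o => x + s *: v) t.
Proof.
apply: smooth_at_add; first exact: smooth_at_cst.
by apply: smooth_at_scale; [exact: smooth_at_id|exact: smooth_at_cst].
Qed.

Lemma near_segment V (x u v : V) (P : V -> Prop) : (\forall y \near x, P y) ->
  exists2 h : R, 0 < h & forall a b, 0 <= a <= h -> 0 <= b <= h ->
    P (x + a *: u + b *: v).
Proof.
move=> /nbhs_ballP[r /= r0 rP].
have N0 : 0 < `|u| + `|v| + 1 by rewrite ltr_wpDl// addr_ge0.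
(* The [+ 1] keeps the divisor positive when [u = v = 0] and makes the final bound by [r] strict. *)
exists (r / (`|u| + `|v| + 1)); first exact: divr_gt0.
move=> a b /andP[a0 ah] /andP[b0 bh]; apply: rP.
rewrite -ball_normE /= -addrA opprD addNKr normrN.
apply: (le_lt_trans (ler_normD _ _)); rewrite !normrZ !ger0_norm //.
set h := r / _ in ah bh.
have h0 : 0 < h by exact: divr_gt0.
have -> : r = h * (`|u| + `|v| + 1) by rewrite divfK // gt_eqF.
rewrite !mulrDr mulr1 ltr_pwDr // lerD // ler_wpM2r //.
Qed.

Lemma MVT_line V (f : V -> R^o) (y w : V) (h : R) : 0 < h ->
  (forall t, 0 <= t <= h -> differentiable f (y + t *: w)) ->
  exists2 t, 0 <= t <= h & f (y + h *: w) - f y = h * 'd f (y + t *: w) w.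
Proof.
move=> h0 df.
have dl t : 0 <= t <= h -> is_diff t (fun s : R => f (y + s *: w))
    (fun s => 'd f (y + t *: w) (s *: w)).
  move=> th; have dft := df t th.
  have dw : is_diff t (fun s : R => y + s *: w) (fun s => s *: w).
    have : is_diff t (cst y + ( *:%R ^~ w)) (0 + ( *:%R ^~ w)) by exact: is_diffD.
    by rewrite add0r.
  have [dw1 dw2] := dw.
  apply: DiffDef; first exact: (@differentiable_comp _ _ _ _ (fun s : R => y + s *: w) f).
  rewrite (@diff_comp _ _ _ _ (fun s : R => y + s *: w) f) //.
  by apply/funext => s /=; rewrite dw2.
have dfl t : t \in `]0, h[%R ->
    is_derive t 1 (fun s : R => f (y + s *: w)) ('d f (y + t *: w) w).
  rewrite in_itv /= => /andP[t0 th].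
  have th' : 0 <= t <= h by rewrite !ltW.
  have [d1 d2] := dl t th'.
  apply: DeriveDef; first exact: diff_derivable.
  by rewrite deriveE // d2 scale1r.
have [|t tI] := MVT h0 dfl.
  apply: derivable_within_continuous => t; rewrite in_itv /= => th.
  by have [d1 _] := dl t th; exact: diff_derivable.
rewrite scale0r addr0 subr0 => E; exists t; last by rewrite E mulrC.
by move: tI; rewrite in_itv /= => /andP[? ?]; rewrite !ltW.
Qed.

(* Applied with [u] and [v] exchanged, it expresses the same second difference
   through the other mixed derivative. *)
Lemma second_difference V (f : V -> R^o) (x u v : V) (h : R) : 0 < h ->
  (forall a b, 0 <= a <= h -> 0 <= b <= h ->
    differentiable f (x + a *: u + b *: v) /\
    differentiable (fun y => 'd f y u : R^o) (x + a *: u + b *: v)) ->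
  exists a b, [/\ 0 <= a <= h, 0 <= b <= h &
    f (x + h *: u + h *: v) - f (x + h *: u) - (f (x + h *: v) - f x) =
    h * h * 'd (fun y => 'd f y u : R^o) (x + a *: u + b *: v) v].
Proof.
move=> h0 df.
have hh : 0 <= h <= h by rewrite lexx ltW.
have h00 : 0 <= (0 : R) <= h by rewrite lexx ltW.
pose g y : R^o := f (y + h *: v) - f y.
have dg t : 0 <= t <= h -> is_diff (x + t *: u) g
    (fun w => 'd f (x + t *: u + h *: v) w - 'd f (x + t *: u) w).
  move=> th; have [d1 _] := df t h th hh.
  have [] := df t 0 th h00; rewrite scale0r addr0 => d2 _.
  have ds : is_diff (x + t *: u) (fun y => y + h *: v) id.
    have : is_diff (x + t *: u) (id + cst (h *: v)) (id + 0) by exact: is_diffD.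
    by rewrite addr0.
  have [ds1 ds2] := ds.
  have dsh : is_diff (x + t *: u) (fun y => f (y + h *: v))
      (fun w => 'd f (x + t *: u + h *: v) w).
    apply: DiffDef.
    exact: (@differentiable_comp _ _ _ _ (fun y => y + h *: v) f).
    rewrite (@diff_comp _ _ _ _ (fun y => y + h *: v) f) //.
    by apply/funext => s /=; rewrite ds2.
  exact: (@is_diffB _ _ _ _ f _ ('d f (x + t *: u)) _ dsh (differentiableP d2)).
have [|a ah] := @MVT_line _ g x u h h0.
  by move=> t /dg [].
rewrite /g => E; have [_ dga] := dg a ah.
rewrite {}dga in E.
have [|b bh E2] := @MVT_line _ (fun y => 'd f y u : R^o) (x + a *: u) v h h0.
  by move=> t th; have [] := df a t ah th.
by exists a, b; split => //; rewrite E E2 mulrA.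
Qed.

(** The second difference over a small parallelogram is [h * h] times either mixed derivative, each
    taken at some point of the parallelogram; by continuity both are as close as desired to their
    values at [x]. *)
Lemma schwarz_scalar V (f : V -> R^o) (x u v : V) : Ck_near 2 f x ->
  'd (fun y => 'd f y u : R^o) x v = 'd (fun y => 'd f y v : R^o) x u.
Proof.
move=> f2.
(* The claim is symmetric in [u] and [v], so one inequality up to an arbitrary [e] suffices. *)
wlog suff key : u v / forall e, 0 < e ->
  'd (fun y => 'd f y u : R^o) x v <= 'd (fun y => 'd f y v : R^o) x u + e.
  apply/eqP; rewrite eq_le; apply/andP; split; apply/ler_addgt0Pr => e e0;
  exact: key.
move=> e e0.
have cd w w' : \forall y \near x,
   `|'d (fun y => 'd f y w : R^o) x w' - 'd (fun y => 'd f y w : R^o) y w'| < e / 2.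
  have := Ck_near_continuous (Ck_near_diff w' (Ck_near_diff w f2)).
  by move/cvgrPdist_lt; apply; rewrite divr_gt0.
have df := Ck_near_differentiable (Ck_nearW f2).
have dd w := Ck_near_differentiable (Ck_near_diff w f2).
have [h h0 hP] := near_segment u v (filterI (filterI df (dd u)) (filterI (filterI (cd u v) (cd v u)) (dd v))).
have [|a [b [ah bh E1]]] := @second_difference _ f x u v h h0.
  by move=> a b ah bh; have [[? ?] _] := hP a b ah bh.
have [|a' [b' [ah' bh' E2]]] := @second_difference _ f x v u h h0.
  move=> a' b' ah' bh'; have [[? _] [_ ?]] := hP b' a' bh' ah'.
  by rewrite addrAC.
have [_ [[B1 _] _]] := hP a b ah bh.
have [_ [[_ B2] _]] := hP b' a' bh' ah'.
rewrite addrAC in B2.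
have E : 'd (fun y => 'd f y u : R^o) (x + a *: u + b *: v) v =
         'd (fun y => 'd f y v : R^o) (x + a' *: v + b' *: u) u.
  apply: (mulfI (_ : h * h != 0)); first by rewrite mulf_neq0 // gt_eqF.
  have swap (A B C D : R) : A - B - (C - D) = A - C - (B - D).
    by rewrite !opprB !addrA [A - B + D]addrAC [A - C + D]addrAC [_ - B - C]addrAC.
  by rewrite -E1 -E2 (addrAC x (h *: v)); exact: swap.
have dist2 (p q r : R) : `|p - r| < e / 2 -> `|q - r| < e / 2 -> p <= q + e.
  rewrite !ltr_distl => /andP[_ pr] /andP[qr _].
  have rq : r < q + e / 2 by rewrite -ltrBlDr.
  by rewrite ltW // (lt_trans pr) // [in ltRHS](splitr e) addrA ltrD2r.
by apply: dist2 B2; rewrite -E.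
Qed.

End SmoothAt.

(** * Vector-valued Schwarz theorem and differentials in a moving direction *)

Section SecondDifferential.
Context {R : realType}.
Implicit Types U V W : normedModType R.

Lemma diff_lincomp V W W' (l : {linear W -> W'}) (f : V -> W) x v :
  continuous l -> differentiable f x ->
  'd (fun y => l (f y)) x v = l ('d f x v).
Proof.
move=> cl df.
rewrite (@diff_comp _ _ _ _ f l _ df (linear_differentiable _ cl)) /=.
by rewrite (diff_lin _ cl).
Qed.

Lemma schwarz V W (f : V -> W) (x u v : V) : finite_dim W -> Ck_near 2 f x ->
  'd (fun y => 'd f y u) x v = 'd (fun y => 'd f y v) x u.
Proof.
move=> [m [e [l [cl le]]]] f2.
have df := Ck_near_differentiable (Ck_nearW f2).
have lE i w w' : l i ('d (fun y => 'd f y w) x w') =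
    'd (fun y => 'd (fun y => l i (f y)) y w : R^o) x w'.
  have ddf := nbhs_singleton (Ck_near_differentiable (Ck_near_diff w f2)).
  rewrite -(diff_lincomp _ (cl i) ddf); apply/esym/near_diff.
    by apply: filterS df => y dfy; rewrite diff_lincomp.
  exact: (@differentiable_comp _ _ _ _ (fun y => 'd f y w) (l i) _ ddf
    (linear_differentiable _ (cl i))).
rewrite (le ('d _ x v)) (le ('d _ x u)); apply: eq_bigr => i _; congr (_ *: _).
by rewrite !lE; apply/schwarz_scalar/Ck_near_lincomp.
Qed.

Lemma is_diff_sum V W (m : nat) (f : 'I_m -> V -> W) (df : 'I_m -> V -> W) x :
  (forall i, is_diff x (f i) (df i)) ->
  is_diff x (fun y => \sum_i f i y) (fun v => \sum_i df i v).
Proof.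
elim: m f df => [|m IHm] f df fd.
  have -> : (fun y => \sum_(i < 0) f i y) = cst 0.
    by apply/funext => y; rewrite big_ord0.
  have -> : (fun v => \sum_(i < 0) df i v) = 0.
    by apply/funext => y; rewrite big_ord0.
  exact: is_diff_cst.
have -> : (fun y => \sum_(i < m.+1) f i y) =
    f ord0 + (fun y => \sum_(i < m) f (lift ord0 i) y).
  by apply/funext => y; rewrite big_ord_recl.
have -> : (fun y => \sum_(i < m.+1) df i y) =
    df ord0 + (fun y => \sum_(i < m) df (lift ord0 i) y).
  by apply/funext => y; rewrite big_ord_recl.
by apply: is_diffD; exact: IHm.
Qed.

(** Leibniz rule when both the base point and the direction of a differential move: in the expansion
    of [w y] on the [e i], each term is a scalar function times a differential in a fixed
    direction. *)
Lemma is_diff_eval U V W (f : V -> W) (q w : U -> V) x : finite_dim V ->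
  Ck_near 2 f (q x) -> differentiable q x -> differentiable w x ->
  is_diff x (fun y => 'd f (q y) (w y))
    (fun h => 'd (fun z => 'd f z (w x)) (q x) ('d q x h) + 'd f (q x) ('d w x h)).
Proof.
move=> [m [e [l [cl le]]]] f2 dq dw.
have dfe i := nbhs_singleton (Ck_near_differentiable (Ck_near_diff (e i) f2)).
have dl i : is_diff x (fun y => l i (w y)) (fun h => l i ('d w x h)).
  apply: DiffDef.
    exact: (@differentiable_comp _ _ _ _ w (l i) _ dw (linear_differentiable _ (cl i))).
  by apply/funext => h; rewrite diff_lincomp.
have dqe i : is_diff x (fun y => 'd f (q y) (e i))
    (fun h => 'd (fun z => 'd f z (e i)) (q x) ('d q x h)).
  apply: DiffDef.
    exact: (@differentiable_comp _ _ _ _ q (fun z => 'd f z (e i))).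
  by rewrite (@diff_comp _ _ _ _ q (fun z => 'd f z (e i))).
have dfw : is_diff (q x) (fun z => 'd f z (w x))
    (fun h => \sum_i (l i (w x) *: 'd (fun z => 'd f z (e i)) (q x) h)).
  have -> : (fun z => 'd f z (w x)) = (fun z => \sum_i l i (w x) *: 'd f z (e i)).
    apply/funext => z; rewrite [in LHS](le (w x)) linear_sum.
    by apply: eq_bigr => i _; rewrite linearZ.
  apply: is_diff_sum => i.
  exact: (@is_diffZ _ _ _ (fun z => 'd f z (e i)) _ (l i (w x)) _ (differentiableP (dfe i))).
have -> : (fun y => 'd f (q y) (w y)) = (fun y => \sum_i l i (w y) *: 'd f (q y) (e i)).
  apply/funext => z; rewrite [in LHS](le (w z)) linear_sum.
  by apply: eq_bigr => i _; rewrite linearZ.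
have [_ ->] := dfw.
have -> : (fun h => \sum_i l i (w x) *: 'd (fun z => 'd f z (e i)) (q x) ('d q x h) +
     'd f (q x) ('d w x h)) =
  (fun h => \sum_i (l i (w x) *: 'd (fun z => 'd f z (e i)) (q x) ('d q x h)
              + l i ('d w x h) *: 'd f (q x) (e i))).
  apply/funext => h; rewrite big_split /=; congr (_ + _).
  rewrite [in LHS](le ('d w x h)) linear_sum.
  by apply: eq_bigr => i _; rewrite linearZ.
apply: is_diff_sum => i.
have [d1 E1] := dl i; have [d2 E2] := dqe i.
have [d3 E3] := is_diff_scale d1 d2.
by apply: DiffDef; rewrite // E3 E1 E2.
Qed.

Lemma diff_eval U V W (f : V -> W) (q w dq dw : U -> V) x h : finite_dim V ->
  Ck_near 2 f (q x) -> is_diff x q dq -> is_diff x w dw ->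
  'd (fun y => 'd f (q y) (w y)) x h =
  'd (fun z => 'd f z (w x)) (q x) (dq h) + 'd f (q x) (dw h).
Proof.
move=> fV f2 [q1 <-] [w1 <-].
by have [_] := is_diff_eval fV f2 q1 w1; exact: (congr1 (fun F => F h)).
Qed.

End SecondDifferential.

(** * Maps into manifolds and their velocities *)

Section ManifoldValued.
Context {R : realType}.
Implicit Types V W : normedModType R.

Lemma chart_at_atlas n (M : manifold R n) (x : M) : atlas (chart_at x).
Proof. by rewrite /chart_at; case: cid2. Qed.

Lemma chart_at_source n (M : manifold R n) (x : M) : source (chart_at x) x.
Proof. by rewrite /chart_at; case: cid2. Qed.

Lemma source_target n (T : topologicalType) (c : chart R n T) x :
  source c x -> target c (c x).
Proof. by exists x. Qed.

Lemma source_param n (T : topologicalType) (c : chart R n T) u :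
  target c u -> source c (param c u).
Proof. by move=> [x sx <-]; rewrite coordK. Qed.

Lemma paramK n (T : topologicalType) (c : chart R n T) u :
  target c u -> c (param c u) = u.
Proof. by move=> [x sx <-]; rewrite coordK. Qed.

Lemma near_source n (T : topologicalType) (c : chart R n T) x :
  source c x -> \forall y \near x, source c y.
Proof. by move=> sx; apply: open_nbhs_nbhs; split => //; exact: source_open. Qed.

Lemma near_target n (T : topologicalType) (c : chart R n T) u :
  target c u -> \forall w \near u, target c w.
Proof. by move=> sx; apply: open_nbhs_nbhs; split => //; exact: target_open. Qed.

Lemma near_param n (T : topologicalType) (c : chart R n T) x (P : T -> Prop) :
  source c x -> (\forall y \near x, P y) -> \forall u \near c x, P (param c u).
Proof.
move=> sx Px.
have pc : param c @ c x --> param c (c x) := param_continuous (source_target sx).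
by rewrite coordK // in pc; exact: pc.
Qed.

Lemma near_source_comp V n (T : topologicalType) (c : chart R n T) (f : V -> T) x :
  {for x, continuous f} -> source c (f x) -> \forall y \near x, source c (f y).
Proof. by move=> cf sx; exact: cf (near_source sx). Qed.

Lemma smooth_transition n (M : manifold R n) (c c' : chart R n M) x :
  atlas c -> atlas c' -> source c x -> source c' x ->
  smooth_at (c' \o param c) (c x).
Proof.
move=> ac ac' sx sx'; apply: smooth_on_near (atlas_smooth ac ac') _.
apply: filterS2 (near_target (source_target sx)) (near_param sx (near_source sx')).
by move=> u tu su; exists (param c u); [split=> //; exact: source_param|exact: paramK].
Qed.

(** A pointwise notion on an arbitrary normed domain: it covers curves, inverse charts and
    two-parameter maps alike, including those that are controlled only near a point. *)
Definition msmooth V n (M : manifold R n) (f : V -> M) (x : V) :=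
  {for x, continuous f} /\
  forall c, atlas c -> source c (f x) -> smooth_at (fun y => c (f y)) x.

(** One chart suffices, since the transition maps of the atlas are smooth. *)
Lemma msmooth_chart V n (M : manifold R n) (f : V -> M) (x : V) c :
  {for x, continuous f} -> atlas c -> source c (f x) ->
  smooth_at (fun y => c (f y)) x -> msmooth f x.
Proof.
move=> cf ac sx fs; split => // c' ac' sx'.
have tr := smooth_transition ac ac' sx sx'.
apply: smooth_at_eq (smooth_at_comp (@finite_dim_rV R n) fs tr).
by apply: filterS (near_source_comp cf sx) => y sy /=; rewrite coordK.
Qed.

Lemma msmooth_cst V n (M : manifold R n) (y : M) (x : V) : msmooth (fun=> y) x.
Proof. by split=> [|c _ _]; [exact: cst_continuous|exact: smooth_at_cst]. Qed.

Lemma msmooth_param n (M : manifold R n) (c : chart R n M) u :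
  atlas c -> target c u -> msmooth (param c) u.
Proof.
move=> ac tu; apply: (@msmooth_chart _ _ _ _ _ c) => //.
- exact: param_continuous.
- exact: source_param.
- apply: smooth_at_eq (smooth_at_id u).
  by apply: filterS (near_target tu) => w /paramK.
Qed.

Lemma msmooth_comp V W n (M : manifold R n) (f : W -> M) (q : V -> W) (x : V) :
  finite_dim W -> smooth_at q x -> msmooth f (q x) -> msmooth (fun y => f (q y)) x.
Proof.
move=> fW qs [cf fs]; split.
  exact: continuous_comp (smooth_at_continuous qs) cf.
by move=> c ac sc; exact: smooth_at_comp fW qs (fs c ac sc).
Qed.

Lemma msmooth_map V m n (M : manifold R m) (N : manifold R n) (h : M -> N)
    (f : V -> M) (x : V) :
  smooth_map h -> msmooth f x -> msmooth (fun y => h (f y)) x.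
Proof.
move=> [ch hs] [cf fs].
have sc := chart_at_source (f x); have ac := chart_at_atlas (f x).
set c := chart_at (f x) in sc ac.
have sc' := chart_at_source (h (f x)); have ac' := chart_at_atlas (h (f x)).
set c' := chart_at (h (f x)) in sc' ac'.
have chf : {for x, continuous (fun y => h (f y))} by exact: continuous_comp cf (ch _).
apply: (msmooth_chart chf ac' sc').
have {}hs : smooth_at (c' \o h \o param c) (c (f x)).
  apply: smooth_on_near (hs c c' ac ac') _.
  have := near_param sc (ch _ _ (near_source sc')).
  apply: filterS2 (near_target (source_target sc)) => u tu su.
  by exists (param c u); [split=> //; exact: source_param|exact: paramK].
apply: smooth_at_eq (smooth_at_comp (@finite_dim_rV R m) (fs c ac sc) hs).
by apply: filterS (near_source_comp cf sc) => y sy /=; rewrite coordK.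
Qed.

Lemma msmooth_map2 V m n l (M : manifold R m) (N : manifold R n)
    (P : manifold R l) (h : M -> N -> P) (f : V -> M) (g : V -> N) (x : V) :
  smooth_map2 h -> msmooth f x -> msmooth g x ->
  msmooth (fun y => h (f y) (g y)) x.
Proof.
move=> [ch hs] [cf fs] [cg gs].
have sc := chart_at_source (f x); have ac := chart_at_atlas (f x).
set c := chart_at (f x) in sc ac.
have sd := chart_at_source (g x); have ad := chart_at_atlas (g x).
set d := chart_at (g x) in sd ad.
have sc' := chart_at_source (h (f x) (g x)).
have ac' := chart_at_atlas (h (f x) (g x)).
set c' := chart_at (h (f x) (g x)) in sc' ac'.
have cfg : {for x, continuous (fun y => (f y, g y))} by exact: cvg_pair cf cg.
have chf : {for x, continuous (fun y => h (f y) (g y))}.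
  exact: (@continuous_comp _ _ _ (fun y => (f y, g y)) (fun z => h z.1 z.2)) cfg (ch _).
apply: (msmooth_chart chf ac' sc').
have {}hs : smooth_at (fun u => c' (h (param c u.1) (param d u.2)))
    (c (f x), d (g x)).
  apply: smooth_on_near (hs c d c' ac ad ac') _.
  have c1 : {for (c (f x), d (g x)), continuous
      (fun u : 'rV[R]_m * 'rV[R]_n => (param c u.1, param d u.2))}.
    apply: cvg_pair.
      apply: (@continuous_comp _ _ _ fst (param c) (c (f x), d (g x))).
        exact: cvg_fst.
      exact: param_continuous (source_target sc).
    apply: (@continuous_comp _ _ _ snd (param d) (c (f x), d (g x))).
      exact: cvg_snd.
    exact: param_continuous (source_target sd).
  have n1 : \forall u \near (c (f x), d (g x)), target c u.1.
    exact: (@cvg_fst _ _ (nbhs (c (f x)))) (near_target (source_target sc)).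
  have n2 : \forall u \near (c (f x), d (g x)), target d u.2.
    exact: (@cvg_snd _ _ (nbhs (c (f x)))) (near_target (source_target sd)).
  have n3 : \forall u \near (c (f x), d (g x)), source c' (h (param c u.1) (param d u.2)).
    have pair0 : (param c (c (f x)), param d (d (g x))) = (f x, g x).
      by rewrite !coordK.
    have : \forall z \near (param c (c (f x)), param d (d (g x))), source c' (h z.1 z.2).
      by rewrite pair0; exact: (ch (f x, g x) _ (near_source sc')).
    exact: c1.
  by apply: filterS3 n1 n2 n3 => u ? ? ?; split.
have fd : finite_dim ('rV[R]_m * 'rV[R]_n)%type.
  exact: finite_dim_prod (@finite_dim_rV R m) (@finite_dim_rV R n).
apply: smooth_at_eq (smooth_at_comp fd (smooth_at_pair (fs c ac sc) (gs d ad sd)) hs).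
apply: filterS2 (near_source_comp cf sc) (near_source_comp cg sd) => y sy sy' /=.
by rewrite !coordK.
Qed.

End ManifoldValued.

(** * Velocities, tangent maps and invariance of the metric *)

Section Velocity.
Context {R : realType}.
Implicit Types V W : normedModType R.

Definition vel V n (M : manifold R n) (f : V -> M) (x v : V) : 'rV[R]_n :=
  'd (fun y => chart_at (f x) (f y)) x v.

Lemma near_coordK V n (T : topologicalType) (c : chart R n T) (f : V -> T) x :
  {for x, continuous f} -> source c (f x) ->
  \forall y \near x, param c (c (f y)) = f y.
Proof.
by move=> cf sx; apply: filterS (near_source_comp cf sx) => y; exact: coordK.
Qed.

Lemma msmooth_coord V n (M : manifold R n) (f : V -> M) (x : V) c :
  msmooth f x -> atlas c -> source c (f x) ->
  smooth_at (fun y => c (f y)) x.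
Proof. by move=> [_ fs]; exact: fs. Qed.

Lemma msmooth_coord_at V n (M : manifold R n) (f : V -> M) (x : V) :
  msmooth f x -> smooth_at (fun y => chart_at (f x) (f y)) x.
Proof.
by move=> fs; apply: msmooth_coord fs _ _;
  [exact: chart_at_atlas|exact: chart_at_source].
Qed.

(** Near [x] one has [param c (c (f y)) = f y], so [g \o f] factors through the coordinates of [c].
    Change of chart for velocities and their images under tangent maps are both instances. *)
Lemma diff_through V W n (M : manifold R n) (c : chart R n M) (f : V -> M)
    (g : M -> W) x v :
  msmooth f x -> atlas c -> source c (f x) ->
  differentiable (fun u => g (param c u)) (c (f x)) ->
  'd (fun y => g (f y)) x v =
  'd (fun u => g (param c u)) (c (f x)) ('d (fun y => c (f y)) x v).
Proof.
move=> fs ac sx dg.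
have df := smooth_at_differentiable (msmooth_coord fs ac sx).
rewrite -[RHS](congr1 (fun F => F v)
  (@diff_comp _ _ _ _ (fun y => c (f y)) (fun u => g (param c u)) _ df dg)).
apply: near_diff.
  by apply: filterS (near_coordK fs.1 sx) => y /= ->.
exact: (@differentiable_comp _ _ _ _ (fun y => c (f y)) (fun u => g (param c u))).
Qed.

Lemma to_coord_vel V n (M : manifold R n) (f : V -> M) (x v : V) c :
  msmooth f x -> atlas c -> source c (f x) ->
  to_coord c (x := f x) (vel f x v) = 'd (fun y => c (f y)) x v.
Proof.
move=> fs ac sx; have sx' := chart_at_source (f x).
have ac' := chart_at_atlas (f x).
apply/esym; apply: (diff_through (c := chart_at (f x)) (g := c)) => //.
exact: smooth_at_differentiable (smooth_transition ac' ac sx' sx).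
Qed.

Lemma of_coord_vel V n (M : manifold R n) (f : V -> M) (x v : V) c :
  msmooth f x -> atlas c -> source c (f x) ->
  of_coord c (c (f x)) ('d (fun y => c (f y)) x v) = vel f x v.
Proof.
move=> fs ac sx; have sx' := chart_at_source (f x).
have ac' := chart_at_atlas (f x).
rewrite /of_coord coordK //; apply/esym.
apply: (diff_through (c := c) (g := chart_at (f x))) => //.
exact: smooth_at_differentiable (smooth_transition ac ac' sx sx').
Qed.

(** Change of chart for the velocity of the map [param c] itself, whose expression in [c] is the
    identity near [c x]. *)
Lemma of_coordK n (M : manifold R n) (c : chart R n M) x w :
  atlas c -> source c x -> to_coord c (x := x) (of_coord c (c x) w) = w.
Proof.
move=> ac sx; have tx := source_target sx.
have ps := msmooth_param ac tx.
have sp := source_param tx.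
have dc : 'd (fun y => c (param c y)) (c x) w = w.
  by apply: near_diff_id; apply: filterS (near_target tx) => y /paramK.
have := to_coord_vel w ps ac sp.
by rewrite dc {1}/vel {1}coordK // => E; rewrite -[RHS]E /of_coord coordK.
Qed.

Lemma vel_comp V W n (M : manifold R n) (f : W -> M) (q : V -> W) x v :
  msmooth f (q x) -> differentiable q x ->
  vel (fun y => f (q y)) x v = vel f (q x) ('d q x v).
Proof.
move=> fs dq; rewrite /vel.
have df := smooth_at_differentiable (msmooth_coord_at fs).
by rewrite (@diff_comp _ _ _ _ q (fun y => chart_at (f (q x)) (f y)) _ dq df).
Qed.

Lemma tangent_map_vel V m n (M : manifold R m) (N : manifold R n) (h : M -> N)
    (f : V -> M) x v :
  msmooth f x -> msmooth (fun u => h (param (chart_at (f x)) u)) (chart_at (f x) (f x)) ->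
  tangent_map h (x := f x) (vel f x v) = vel (fun y => h (f y)) x v.
Proof.
move=> fs hs; have sx := chart_at_source (f x).
have ac := chart_at_atlas (f x).
apply/esym.
apply: (diff_through (c := chart_at (f x)) (g := fun z => chart_at (h (f x)) (h z))) => //.
by have := smooth_at_differentiable (msmooth_coord_at hs); rewrite coordK.
Qed.

Lemma vel_chart_param n (M : manifold R n) (x : M) w :
  vel (param (chart_at x)) (chart_at x x) w = w.
Proof.
have sx := chart_at_source x; rewrite /vel coordK //.
by apply: near_diff_id; apply: filterS (near_target (source_target sx)) => y /paramK.
Qed.

Section Invariance.
Context {n : nat} {M : manifold R n}.
Variable F : finsler M.

(** The bridge between local computations and invariance: the right side does not mention the chart,
    and isometries act on it. *)
Lemma metric_coord_vel V (f : V -> M) (x v : V) c :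
  msmooth f x -> atlas c -> source c (f x) ->
  metric_coord F c (c (f x), 'd (fun y => c (f y)) x v) = F (f x) (vel f x v).
Proof.
move=> fs ac sx; rewrite /metric_coord /= of_coord_vel //.
by rewrite coordK.
Qed.

Lemma metric_coord_at (x : M) (y : 'rV[R]_n) :
  metric_coord F (chart_at x) (chart_at x x, y) = F x y.
Proof.
have sx := chart_at_source x; have ax := chart_at_atlas x.
have ps := msmooth_param ax (source_target sx).
rewrite /metric_coord /=.
have -> : of_coord (chart_at x) (chart_at x x) y = y by exact: vel_chart_param.
by rewrite coordK.
Qed.

Context {d : nat} {G : lie_group R d}.
Variable a : isometric_action G F.

Lemma msmooth_act V (g : V -> G) (f : V -> M) x :
  msmooth g x -> msmooth f x -> msmooth (fun y => a (g y) (f y)) x.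
Proof. exact: msmooth_map2 (act_smooth a). Qed.

Lemma tangent_map_act V (b : G) (f : V -> M) x v : msmooth f x ->
  tangent_map (a b) (x := f x) (vel f x v) = vel (fun y => a b (f y)) x v.
Proof.
move=> fs; apply: tangent_map_vel => //.
apply: msmooth_act; first exact: msmooth_cst.
by apply: msmooth_param; [exact: chart_at_atlas|exact/source_target/chart_at_source].
Qed.

Lemma metric_act V (b : G) (f : V -> M) x v : msmooth f x ->
  F (a b (f x)) (vel (fun y => a b (f y)) x v) = F (f x) (vel f x v).
Proof. by move=> fs; rewrite -tangent_map_act // act_isometry. Qed.

End Invariance.

End Velocity.

(** * The Chern connection and the Euler-Lagrange equation *)

Section EulerLagrange.
Context {R : realType} {n : nat}.
Local Notation E := ('rV[R]_n).
Implicit Types (L : E * E -> R^o) (z : E * E).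

Lemma finite_dim_pair_rV : finite_dim (E * E)%type.
Proof. exact: finite_dim_prod (@finite_dim_rV R n) (@finite_dim_rV R n). Qed.

Lemma pair_lin (W : lmodType R) (f : {linear (E * E)%type -> W}) (u v : E) :
  f (u, v) = f (u, 0) + f (0, v).
Proof.
rewrite -linearD; congr (f _).
by apply: injective_projections; rewrite /= ?addr0 ?add0r.
Qed.

Lemma pair_linB (W : lmodType R) (f : {linear (E * E)%type -> W}) (u v : E) :
  f (u, v) - f (0, v) = f (u, 0).
Proof. by rewrite (pair_lin f u v) addrK. Qed.

Lemma inr_is_linear : linear (fun w : E => (0, w) : (E * E)%type).
Proof.
by move=> k u v; apply: injective_projections; rewrite /= ?scaler0 ?addr0.
Qed.

Lemma inl_is_linear : linear (fun w : E => (w, 0) : (E * E)%type).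
Proof.
by move=> k u v; apply: injective_projections; rewrite /= ?scaler0 ?addr0.
Qed.

Definition inr_lin : {linear E -> (E * E)%type} :=
  HB.pack (fun w : E => (0, w) : (E * E)%type) (GRing.isLinear.Build _ _ _ _ _ inr_is_linear).

Definition inl_lin : {linear E -> (E * E)%type} :=
  HB.pack (fun w : E => (w, 0) : (E * E)%type) (GRing.isLinear.Build _ _ _ _ _ inl_is_linear).

Lemma lin_inr_sum (f : {linear (E * E)%type -> R^o}) (w : E) :
  f (0, w) = \sum_j w 0 j * f (0, delta_mx 0 j).
Proof.
rewrite {1}(row_sum_delta w) -[LHS]/((f \o inr_lin) _) linear_sum.
by apply: eq_bigr => j _; rewrite linearZ.
Qed.

Lemma lin_inl_sum (f : {linear (E * E)%type -> R^o}) (w : E) :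
  f (w, 0) = \sum_j w 0 j * f (delta_mx 0 j, 0).
Proof.
rewrite {1}(row_sum_delta w) -[LHS]/((f \o inl_lin) _) linear_sum.
by apply: eq_bigr => j _; rewrite linearZ.
Qed.

Definition homogeneous2 L :=
  forall x y (t : R), 0 <= t -> L (x, t *: y) = t ^+ 2 * L (x, y).

(** Differentiate [t |-> L (x, t y)] at [t = 1]; the homogeneity, available for [t >= 0], holds on a
    neighbourhood of 1. *)
Lemma euler_homogeneous2 L z : homogeneous2 L -> differentiable L z ->
  'd L z (0, z.2) = 2 * L z.
Proof.
move=> hL dL; case: z dL => x y dL /=.
pose q (t : R^o) := (x, t *: y).
have q1 : q 1 = (x, y) by rewrite /q scale1r.
have [dq dqE] : is_diff (1 : R^o) q (fun h => (0, h *: y)).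
  by apply: is_diff_pair; exact: is_diff_scalel.
have dLq : differentiable L (q 1) by rewrite q1.
have -> : 'd L (x, y) (0, y) = 'd (fun t => L (q t)) (1 : R^o) 1.
  by rewrite (@diff_comp_app _ _ _ _ q L _ _ dq dLq) q1 dqE scale1r.
rewrite -deriveE; last exact: (@differentiable_comp _ _ _ _ q L).
have tE : \forall t \near (1 : R^o), L (q t) = t ^+ 2 * L (x, y).
  by near=> t; rewrite hL //; near: t; apply: filterS (lt_nbhsr ltr01) => t /ltW.
rewrite (near_eq_derive _ tE) (@deriveMr _ _ (fun t : R => t ^+ 2)).
  by rewrite exp_derive expr1n [_ *: _]mulr1 [_ *: _]mulr1 mulrC.
exact: exprn_derivable.
Unshelve. all: by end_near. Qed.

Lemma second_diff_sym L z u v : Ck_near 2 L z ->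
  'd (fun z1 => 'd L z1 u) z v = 'd (fun z1 => 'd L z1 v) z u.
Proof. by move=> /schwarz; apply; exact: finite_dim_regular. Qed.

End EulerLagrange.

(** * The geodesic equation as an Euler-Lagrange equation *)

Section ChernEulerLagrange.
Context {R : realType} {n : nat}.
Local Notation E := ('rV[R]_n).
Variable L : E * E -> R^o.
Implicit Types (z h : E * E).
Local Notation e := (fun j : 'I_n => delta_mx (0 : 'I_1) j : E).

Lemma diff_vertical (K : E * E -> R^o) z h : Ck_near 2 K z ->
  'd (fun z' => 'd K z' (0, z'.2)) z h =
  'd (fun z' => 'd K z' (0, z.2)) z h + 'd K z (0, h.2).
Proof.
move=> K2.
have ds := is_diff_snd z.
exact: (@diff_eval R _ _ _ K (fun z => z) (fun z' : E * E => (0, z'.2)) _ _ z h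
  (finite_dim_pair_rV (R:=R) (n:=n)) K2 (is_diff_id z) (is_diff_pair (is_diff_cst (0 : E) z) ds)).
Qed.

Lemma near_diff_derive (f g : E * E -> R^o) z v :
  (\forall y \near z, f y = g y) -> differentiable g z -> 'D_v f z = 'd g z v.
Proof. by move=> fg dg; rewrite (near_eq_derive _ fg) deriveE. Qed.

Lemma second_diff_inr (K : E * E -> R^o) z h (w : E) : Ck_near 2 K z ->
  'd (fun z' => 'd K z' (0, w)) z h =
  \sum_j w 0 j * 'd (fun z' => 'd K z' (0, e j)) z h.
Proof.
move=> K2; apply: etrans (second_diff_sym (0, w) h K2) _.
apply: etrans (lin_inr_sum ('d (fun z' => 'd K z' h) z) w) _.
by apply: eq_bigr => j _; congr (_ * _); exact: second_diff_sym.
Qed.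

Hypothesis homL : homogeneous2 L.

(** Differentiate Euler's identity along [h]: the direction [(0, z'.2)] moves with the point and
    contributes ['d L z (0, h.2)]. *)
Lemma diff_euler z h : Ck_near 2 L z ->
  'd (fun z' => 'd L z' (0, z.2)) z h = 2 * 'd L z h - 'd L z (0, h.2).
Proof.
move=> L2; apply/eqP; rewrite eq_sym subr_eq -diff_vertical //; apply/eqP.
have dL := Ck_near_differentiable (Ck_nearW L2).
have dz := nbhs_singleton dL.
have [d2 d2E] := @is_diffZ _ _ _ L _ (2 : R) z (differentiableP dz).
apply/esym; apply: etrans (congr1 (fun F => F h) d2E).
apply: near_diff d2.
by apply: filterS dL => z' dz'; rewrite euler_homogeneous2.
Qed.

(** The vertical derivative of [L] is homogeneous of degree one in [y]; by symmetry of the Hessian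
    this is [diff_euler] along [(0, w)]. *)
Lemma hessian_euler z (w : E) : Ck_near 2 L z ->
  'd (fun z' => 'd L z' (0, w)) z (0, z.2) = 'd L z (0, w).
Proof.
move=> L2; apply: etrans (second_diff_sym _ _ L2) _.
by apply: etrans (diff_euler _ L2) _; rewrite mulr_natl mulr2n addrK.
Qed.

(** The entries of [metric_mx L] rewritten with ['d] in place of directional derivatives, which
    gives access to linearity and symmetry. *)
Definition hess (i j : 'I_n) z : R^o :=
  2^-1 * 'd (fun z' => 'd L z' (0, e j)) z (0, e i).

Lemma metric_mxE z i j : Ck_near 2 L z -> metric_mx L z i j = hess i j z.
Proof.
move=> L2; rewrite mxE; congr (_ * _); rewrite /dy.
apply: near_diff_derive; last exact: nbhs_singleton (Ck_near_differentiable (Ck_near_diff _ L2)).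
by apply: filterS (Ck_near_differentiable (Ck_nearW L2)) => y dy; rewrite deriveE.
Qed.

Lemma hess_sym z i j : Ck_near 2 L z -> hess i j z = hess j i z.
Proof. by move=> L2; congr (_ * _); exact: second_diff_sym. Qed.

Lemma is_diff_hess z i j : Ck_near 3 L z ->
  is_diff z (hess i j) (fun h => 2^-1 *
    'd (fun z1 => 'd (fun z' => 'd L z' (0, e j)) z1 (0, e i)) z h).
Proof.
move=> L3; have L1 := Ck_near_diff (0, e i) (Ck_near_diff (0, e j) L3).
have d1 := nbhs_singleton (Ck_near_differentiable L1).
exact: (@is_diffZ _ _ _ (fun z1 => 'd (fun z' => 'd L z' (0, e j)) z1 (0, e i) : R^o)
   _ (2^-1 : R) z (differentiableP d1)).
Qed.

Lemma derive_metric_mx z i j h : Ck_near 3 L z ->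
  'D_h (fun z => metric_mx L z i j : R^o) z = 'd (hess i j) z h.
Proof.
move=> L3; have [d1 _] := is_diff_hess i j L3; apply: near_diff_derive => //.
by apply: filterS (Ck_near_near (Ck_nearW L3)) => z' L2; rewrite metric_mxE.
Qed.

Lemma diff_hess_sym z i j h : Ck_near 3 L z -> 'd (hess i j) z h = 'd (hess j i) z h.
Proof.
move=> L3; have [d1 _] := is_diff_hess j i L3; apply: near_diff => //.
by apply: filterS (Ck_near_near (Ck_nearW L3)) => z' L2; rewrite hess_sym.
Qed.

(** Obtained by differentiating [hessian_euler] along [h]. For vertical [h] the right side is zero,
    which is the vanishing of the Cartan tensor contracted with [z.2]. *)
Lemma diff_hess_euler z s h : Ck_near 3 L z ->
  \sum_j z.2 0 j * 'd (hess j s) z h =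
  2^-1 * ('d (fun z' => 'd L z' (0, e s)) z h
          - 'd (fun z' => 'd L z' (0, e s)) z (0, h.2)).
Proof.
move=> L3; have K2 := Ck_near_diff (0, e s) L3; set K := fun z' => _ in K2 *.
have dK := nbhs_singleton (Ck_near_differentiable (Ck_nearW K2)).
have E1 : 'd (fun z' => 'd K z' (0, z'.2)) z h = 'd K z h.
  apply: near_diff dK.
  by apply: filterS (Ck_near_near (Ck_nearW L3)) => z' /hessian_euler ->.
have E2 := second_diff_inr h z.2 K2.
have E3 := diff_vertical h K2.
have -> : 'd K z h - 'd K z (0, h.2) = \sum_j z.2 0 j * 'd (fun z' => 'd K z' (0, e j)) z h.
  have cancel (A B C D S : R) : A = D -> A = B + C -> B = S -> D - C = S.
    by move=> <- -> <-; rewrite addrK.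
  exact: cancel E1 E3 E2.
rewrite mulr_sumr; apply: eq_bigr => j _.
have [_ dE] := is_diff_hess j s L3.
apply: etrans (congr1 (fun F => z.2 0 j * F h) dE) _; exact: mulrCA.
Qed.

Lemma horizontalE z i j k : Ck_near 3 L z ->
  horizontal L k (fun z => metric_mx L z i j) z =
  'd (hess i j) z (e k, - \sum_l nonlinear_connection L l k z *: e l).
Proof.
move=> L3; rewrite /horizontal /dx derive_metric_mx //.
apply/esym/(etrans (pair_lin ('d (hess i j) z) _ _)); congr (_ + _).
apply: etrans (lin_inr_sum ('d (hess i j) z) _) _.
rewrite -[RHS]sumrN; apply: eq_bigr => l _.
rewrite /dy derive_metric_mx // -mulNr; congr (_ * _).
rewrite mxE summxE; congr (- _); rewrite (bigD1 l) //= big1 ?addr0.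
  by rewrite !mxE !eqxx mulr1.
by move=> l' ll'; rewrite !mxE eqxx eq_sym (negbTE ll') mulr0.
Qed.

(* The coefficients of the nonlinear connection drop out because the Cartan
   tensor vanishes when contracted with [z.2]. *)
Lemma sum_horizontal_diag z s : Ck_near 3 L z ->
  \sum_j \sum_k (horizontal L k (fun z => metric_mx L z s j) z
     + horizontal L j (fun z => metric_mx L z s k) z
     - horizontal L s (fun z => metric_mx L z j k) z) * z.2 0 j * z.2 0 k =
  'd (fun z' => 'd L z' (0, e s)) z (z.2, 0) - 'd L z (e s, 0).
Proof.
move=> L3; have L2 := Ck_nearW L3.
(* The subtracted term in [diff_hess_euler] removes exactly the vertical component of the horizontal
   direction, leaving [(e k, 0)]. *)
have one i k : \sum_j z.2 0 j * horizontal L k (fun z => metric_mx L z j i) z =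
    2^-1 * 'd (fun z' => 'd L z' (0, e i)) z (e k, 0).
  under eq_bigr do rewrite horizontalE //.
  apply: etrans (diff_hess_euler _ _ L3) _; congr (_ * _).
    exact: (pair_linB ('d (fun z' => 'd L z' (0, e i)) z)).
have hor_sym i j k : horizontal L k (fun z => metric_mx L z i j) z =
    horizontal L k (fun z => metric_mx L z j i) z.
  apply: etrans (horizontalE i j k L3) (etrans (diff_hess_sym i j _ L3) _).
  exact/esym/horizontalE.
have A1 : \sum_j \sum_k horizontal L k (fun z => metric_mx L z s j) z * z.2 0 j * z.2 0 k =
    2^-1 * 'd (fun z' => 'd L z' (0, e s)) z (z.2, 0).
  rewrite exchange_big /= lin_inl_sum mulr_sumr; apply: eq_bigr => k _.
  rewrite mulrCA -one -mulr_suml mulrC; congr (_ * _).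
  by apply: eq_bigr => j _; rewrite mulrC hor_sym.
have A2 : \sum_j \sum_k horizontal L j (fun z => metric_mx L z s k) z * z.2 0 j * z.2 0 k =
    2^-1 * 'd (fun z' => 'd L z' (0, e s)) z (z.2, 0).
  rewrite -A1 exchange_big; apply: eq_bigr => j _; apply: eq_bigr => k _ /=.
  exact: mulrAC.
(* With both indices contracted, [diff_euler] along [(e s, 0)], which has no vertical component,
   turns the second derivative into twice a first one. *)
have A3 : \sum_j \sum_k horizontal L s (fun z => metric_mx L z j k) z * z.2 0 j * z.2 0 k =
    'd L z (e s, 0).
  rewrite exchange_big /=.
  transitivity (2^-1 * 'd (fun z' => 'd L z' (0, z.2)) z (e s, 0)).
    rewrite second_diff_inr // mulr_sumr; apply: eq_bigr => k _.
    rewrite mulrCA -one -mulr_suml mulrC; congr (_ * _).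
    by apply: eq_bigr => j _; rewrite mulrC.
  have E2 := diff_euler (e s, 0) L2.
  have E0 : 'd L z (0, 0) = 0 by exact: (linear0 ('d L z)).
  apply: etrans (congr1 ( *%R 2^-1) E2) _.
  by rewrite E0 subr0 mulKf // pnatr_eq0.
under eq_bigr => j _.
  under eq_bigr => k _ do rewrite mulrBl mulrBl mulrDl mulrDl.
  rewrite big_split /= sumrN big_split /=; over.
rewrite big_split /= sumrN big_split /= A1 A2 A3; congr (_ - _).
by rewrite -mulrDl -[X in (X + X)]div1r -splitr mul1r.
Qed.

(** Here [v] is the acceleration. Lowering the index of the covariant derivative with [2 g] gives
    the Euler-Lagrange expression on each basis vector, so invertibility of [g] makes both equations
    equivalent. *)
Lemma geodesic_equation_euler_lagrange z (v : E) : Ck_near 3 L z -> metric_mx L z \in unitmx ->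
  (\row_i (v 0 i + \sum_j \sum_k chern L i j k z * z.2 0 j * z.2 0 k) = 0) <->
  (forall w : E, 'd (fun z' => 'd L z' (0, w)) z (z.2, v) = 'd L z (w, 0)).
Proof.
move=> L3 gU; have L2 := Ck_nearW L3.
set cov := \row_i _; set g := metric_mx L z in gU *.
(* The Euler-Lagrange expression without its acceleration term. *)
pose A : E := \row_s ('d (fun z' => 'd L z' (0, e s)) z (z.2, 0) - 'd L z (e s, 0)).
have gT : g^T = g.
  by apply/matrixP => i j; rewrite mxE !metric_mxE // hess_sym.
have covE : cov = v + 2^-1 *: (A *m invmx g).
  apply/rowP => i; rewrite !mxE; congr (_ + _).
  have giT s : invmx g s i = invmx g i s.
    by rewrite -[in LHS]gT -trmx_inv mxE.
  transitivity (\sum_s \sum_j \sum_k 2^-1 * invmx g i s *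
      (horizontal L k (fun z => metric_mx L z s j) z
     + horizontal L j (fun z => metric_mx L z s k) z
     - horizontal L s (fun z => metric_mx L z j k) z) * z.2 0 j * z.2 0 k).
    rewrite [RHS]exchange_big; apply: eq_bigr => j _ /=.
    rewrite [RHS]exchange_big; apply: eq_bigr => k _ /=.
    rewrite /chern mulr_sumr !mulr_suml; apply: eq_bigr => s _.
    by rewrite !mulrA.
  rewrite mulr_sumr; apply: eq_bigr => s _.
  rewrite giT mxE -sum_horizontal_diag // [in RHS](mulrC _ (invmx g i s)) mulrA.
  rewrite mulr_sumr; apply: eq_bigr => j _.
  by rewrite mulr_sumr; apply: eq_bigr => k _; rewrite !mulrA.
have ELE s : 'd (fun z' => 'd L z' (0, e s)) z (z.2, v) - 'd L z (e s, 0) =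
    2 * (cov *m g) 0 s.
  rewrite covE mulmxDl -scalemxAl mulmxKV // mxE mulrDr [X in _ + 2 * X]mxE mulVKf ?pnatr_eq0 //.
  rewrite [A 0 s]mxE addrA; congr (_ - _).
  apply: etrans (pair_lin ('d (fun z' => 'd L z' (0, e s)) z) _ _) _.
  rewrite addrC; congr (_ + _).
  apply: etrans (lin_inr_sum ('d (fun z' => 'd L z' (0, e s)) z) _) _.
  rewrite mxE mulr_sumr; apply: eq_bigr => i _.
  by rewrite metric_mxE // mulrCA mulVKf // pnatr_eq0.
split=> [cov0 w|EL].
  apply/eqP; rewrite -subr_eq0; apply/eqP.
  have E1 := second_diff_inr (z.2, v) w L2.
  have E2 := lin_inl_sum ('d L z) w.
  apply: etrans (f_equal2 (fun a b : R => a - b) E1 E2) _.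
  rewrite -sumrB big1 // => s _.
  by rewrite -mulrBr ELE cov0 mul0mx mxE !mulr0.
have : cov *m g = 0.
  apply/rowP => s; have := ELE s; rewrite EL subrr mxE => /esym/eqP.
  by rewrite mulf_eq0 pnatr_eq0 /= => /eqP ->; rewrite mxE.
by move/(congr1 (mulmx^~ (invmx g))); rewrite mulmxK // mul0mx.
Qed.

End ChernEulerLagrange.

(** * Local expressions of the metric and of the fundamental tensor *)

Section FinslerCoordinates.
Context {R : realType} {n : nat} {M : manifold R n}.
Variable F : finsler M.
Local Notation E := ('rV[R]_n).

Definition energy (c : chart R n M) (z : E * E) : R^o := metric_coord F c z ^+ 2.

Lemma smooth_at_energy c z : atlas c -> target c z.1 -> z.2 != 0 ->
  smooth_at (energy c) z.
Proof.
move=> ac tz z0.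
have s1 : smooth_at (metric_coord F c : E * E -> R^o) z.
  apply: (smooth_on_near (metric_smooth F ac)).
  have n1 : \forall u \near z, target c u.1.
    have c1 : {for z, continuous (@fst E E)} by exact: cvg_fst.
    exact: c1 (near_target tz).
  have n2 : \forall u \near z, u.2 != 0.
    have c2 : {for z, continuous (@snd E E)} by exact: cvg_snd.
    exact: cvgr_neq0 c2 z0.
  by apply: filterS2 n1 n2 => u.
apply: smooth_at_eq (smooth_at_scale s1 s1).
by apply: filterE => u; rewrite /energy expr2.
Qed.

Lemma of_coordD c u (v w : E) : of_coord (M := M) c u (v + w) = of_coord c u v + of_coord c u w.
Proof. exact: linearD. Qed.

Lemma of_coordZ c u k (w : E) : of_coord (M := M) c u (k *: w) = k *: of_coord c u w.
Proof. exact: linearZ. Qed.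

Lemma energy_homogeneous2 c : homogeneous2 (energy c).
Proof.
move=> x y t t0; rewrite /energy /metric_coord /= of_coordZ.
by rewrite metric_homogeneous // exprMn.
Qed.

Lemma derive1_line (V : normedModType R) (K : V -> R^o) z v : differentiable K z ->
  derive1 (V := R^o) (fun t : R => K (z + t *: v)) 0 = 'd K z v.
Proof.
move=> dK.
have dl : is_diff (0 : R^o) (fun t : R^o => z + t *: v) (fun t => t *: v).
  have := @is_diffD _ _ _ _ _ _ _ (0 : R^o) (is_diff_cst z (0 : R^o)) (is_diff_scalel 0 v).
  by rewrite add0r.
have [d1 d2] := dl.
have dK0 : differentiable K (z + (0 : R^o) *: v) by rewrite scale0r addr0.
rewrite derive1E'; last exact: (@differentiable_comp _ _ _ _ (fun t : R^o => z + t *: v) K).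
rewrite (@diff_comp_app _ R^o _ _ (fun t : R^o => z + t *: v) K 0 1 d1 dK0) d2 scale1r.
by rewrite scale0r addr0.
Qed.

(** At a fixed point [of_coord] is linear, so the affine plane used in [fundamental_tensor] comes
    from an affine plane in the fibre coordinates of [c]. *)
Lemma fundamental_tensor_coord c (x : M) (y u v : E) :
  atlas c -> source c x -> y != 0 ->
  fundamental_tensor F x (of_coord c (c x) y) (of_coord c (c x) u) (of_coord c (c x) v) =
  2^-1 * 'd (fun z => 'd (energy c) z (0, v) : R^o) (c x, y) (0, u).
Proof.
move=> ac sx y0; rewrite /fundamental_tensor; congr (_ * _).
have sL : smooth_at (energy c) (c x, y).
  by apply: smooth_at_energy => //; exact: source_target.
have dK := smooth_at_differentiable (smooth_at_diff (0, v) sL).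
rewrite -derive1_line // !derive1E; apply: near_eq_derive.
have cl : {for (0 : R), continuous (fun s : R => ((c x, y) + s *: (0, u) : E * E))}.
  apply: (@continuousD _ _ _ (cst ((c x, y) : E * E))); first exact: cst_continuous.
  exact: scalel_continuous.
(* The inner derivative is a differential of the energy only where the latter is differentiable; as
   [y != 0], this holds for [s] near 0. *)
have dn : \forall s \near (0 : R), differentiable (energy c) ((c x, y) + s *: (0, u)).
  have : \forall z \near ((c x, y) + (0 : R) *: (0, u) : E * E), differentiable (energy c) z.
    by rewrite scale0r addr0; exact: smooth_at_near_differentiable.
  exact: cl.
apply: filterS dn => s ds; rewrite -derive1_line //.
congr (derive1 _ 0); apply/funext => t.
rewrite /energy /metric_coord -!of_coordZ -!of_coordD /=.
rewrite !scaler0 !addr0 coordK //.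
Qed.

Lemma of_coord_chart_at (x : M) (w : E) : of_coord (chart_at x) (chart_at x x) w = w.
Proof. exact: vel_chart_param. Qed.

(** By Euler's identity for the Hessian, [g_y(y, v)] is a first derivative of [F^2]. In this form
    the bracket condition meets the Euler-Lagrange expression. *)
Lemma fundamental_tensor_radial (x : M) (y v : E) : y != 0 ->
  fundamental_tensor F x y y v =
  2^-1 * 'd (fun w : E => F x w ^+ 2 : R^o) y v.
Proof.
move=> y0; have ax := chart_at_atlas x; have sx := chart_at_source x.
have sL : smooth_at (energy (chart_at x)) (chart_at x x, y).
  by apply: smooth_at_energy => //; exact: source_target.
have E1 := @fundamental_tensor_coord _ x y y v ax sx y0.
rewrite !of_coord_chart_at in E1.
apply: etrans E1 _; congr (_ * _).
apply: etrans (hessian_euler (@energy_homogeneous2 _) v (sL 2)) _.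
have dL := smooth_at_differentiable sL.
have dp : is_diff y (fun w : E => (chart_at x x, w)) (fun w => (0, w)).
  exact: (is_diff_pair (is_diff_cst (chart_at x x : E) y) (is_diff_id y)).
have [d1 d2] := dp.
have -> : (fun w : E => F x w ^+ 2 : R^o) =
    (fun w => energy (chart_at x) (chart_at x x, w)).
  by apply/funext => w; rewrite /energy metric_coord_at.
apply/esym; apply: etrans (diff_comp_app v d1 dL) _.
by rewrite d2.
Qed.

Lemma differentiable_sqr_metric (x : M) (y : E) : y != 0 ->
  differentiable (fun w : E => F x w ^+ 2 : R^o) y.
Proof.
move=> y0; have ax := chart_at_atlas x; have sx := chart_at_source x.
have sL : smooth_at (energy (chart_at x)) (chart_at x x, y).
  by apply: smooth_at_energy => //; exact: source_target.
have [d1 _] := is_diff_pair (is_diff_cst (chart_at x x : E) y) (is_diff_id y).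
have -> : (fun w : E => F x w ^+ 2 : R^o) =
    (energy (chart_at x)) \o (fun w => (chart_at x x, w)).
  by apply/funext => w; rewrite /energy /= metric_coord_at.
exact: differentiable_comp d1 (smooth_at_differentiable sL).
Qed.

(* At [y = 0] the inner derivative does not depend on [s]. *)
Lemma fundamental_tensor0 (x : M) (v : E) : fundamental_tensor F x 0 0 v = 0.
Proof.
rewrite /fundamental_tensor.
rewrite (_ : (fun s : R => _) = cst (derive1 (V := R^o)
    (fun t : R => F x (0 + t *: v) ^+ 2) 0)).
  by rewrite derive1_cst mulr0.
by apply/funext => s; rewrite scaler0 addr0.
Qed.

(** A nonzero row vector [w] killed by the matrix would give [g_y(w, w) = 0], against strong
    convexity. *)
Lemma metric_mx_unit c (x : M) (y : E) : atlas c -> source c x -> y != 0 ->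
  metric_mx (energy c) (c x, y) \in unitmx.
Proof.
move=> ac sx y0; rewrite -row_free_unit; apply: inj_row_free => w wg.
have sL : smooth_at (energy c) (c x, y).
  by apply: smooth_at_energy => //; exact: source_target.
apply/eqP; apply: contraT => w0.
(* [of_coord] is injective because [to_coord] inverts it. *)
have nz u : u != 0 -> of_coord (M := M) c (c x) u != 0.
  apply: contra_neq => u0; rewrite -(of_coordK u ac sx) u0.
  exact: linear0.
have := metric_convex F x (nz y y0) (nz w w0).
rewrite fundamental_tensor_coord //.
have E1 := second_diff_inr (0, w) w (sL 2).
have E2 j := lin_inr_sum ('d (fun z' => 'd (energy c) z' (0, delta_mx 0 j)) (c x, y)) w.
rewrite (_ : 2^-1 * _ = 0) ?ltxx //.
apply: etrans (congr1 ( *%R 2^-1) E1) _.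
transitivity ((w *m metric_mx (energy c) (c x, y) *m w^T) 0 0).
  rewrite mxE mulr_sumr; apply: eq_bigr => j _.
  rewrite [w^T j 0]mxE mulrCA mulrC; congr (_ * _).
  rewrite mxE (E2 j) mulr_sumr; apply: eq_bigr => i _.
  by rewrite (metric_mxE _ _ (sL 2)) mulrCA.
by rewrite wg mul0mx mxE.
Qed.

End FinslerCoordinates.

(** * The Lie bracket as the derivative of Ad *)

Section VelocityAt.
Context {R : realType}.
Implicit Types V W : normedModType R.

(** The preferred chart depends on the point as a term, and points such as [f x] and [y] are often
    only provably equal. This variant and the next two take the equality as a hypothesis. *)
Lemma tangent_map_vel_at V m n (M : manifold R m) (N : manifold R n) (h : M -> N)
    (f : V -> M) x v y :
  f x = y -> msmooth f x -> msmooth (fun u => h (param (chart_at y) u)) (chart_at y y) ->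
  tangent_map h (x := y) (vel f x v) = vel (fun z => h (f z)) x v.
Proof. by move=> <-; exact: tangent_map_vel. Qed.

Lemma to_coord_vel_at V n (M : manifold R n) (f : V -> M) (x v : V) c y :
  f x = y -> msmooth f x -> atlas c -> source c y ->
  to_coord c (x := y) (vel f x v) = 'd (fun z => c (f z)) x v.
Proof. by move=> <-; exact: to_coord_vel. Qed.

Lemma velE_at V n (M : manifold R n) (f : V -> M) (x v : V) y :
  f x = y -> vel f x v = 'd (fun z => chart_at y (f z)) x v.
Proof. by move=> <-. Qed.

Lemma msmooth_chart_param n (M : manifold R n) (y : M) :
  msmooth (param (chart_at y)) (chart_at y y).
Proof.
by apply: msmooth_param; [exact: chart_at_atlas|exact/source_target/chart_at_source].
Qed.

Lemma smooth_curve_msmooth n (M : manifold R n) (s : R -> M) (t : R) :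
  smooth_curve s -> msmooth (V := R^o) s t.
Proof.
move=> [cs ss]; split=> [|c ac sc]; first exact: cs.
by apply: smooth_on_near (ss c ac) _; exact: cs (near_source sc).
Qed.

Lemma msmooth_curve n (M : manifold R n) (s : R -> M) :
  (forall t, msmooth (V := R^o) s t) -> smooth_curve s.
Proof.
move=> ss; split=> [t|c ac]; first exact: (ss t).1.
by apply: smooth_at_on => t sc; exact: (ss t).2.
Qed.

Lemma finite_dim_plane : finite_dim (R^o * R^o)%type.
Proof. exact: finite_dim_prod (@finite_dim_regular R) (@finite_dim_regular R). Qed.

End VelocityAt.

(** * The group law in the chart at the identity *)

Section LieGroups.
Context {R : realType} {d : nat} (G : lie_group R d).
Implicit Types (V : normedModType R) (g b : G).
Local Notation cG := (chart_at (gone G)).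
Local Notation u0 := (cG (gone G)).
Local Notation beta := (param cG).

Lemma gmulgV g : gmul g (ginv g) = gone G.
Proof.
rewrite -[LHS]gmul1 -{1}(gmulV (ginv g)) -gmulA (gmulA (ginv g)) gmulV gmul1.
exact: gmulV.
Qed.

Lemma gmulg1 g : gmul g (gone G) = g.
Proof. by rewrite -(gmulV g) gmulA gmulgV gmul1. Qed.

Lemma beta0 : beta u0 = gone G.
Proof. by rewrite coordK //; exact: chart_at_source. Qed.

Lemma msmooth_mul V (f g : V -> G) x :
  msmooth f x -> msmooth g x -> msmooth (fun y => gmul (f y) (g y)) x.
Proof. exact: msmooth_map2 (@gmul_smooth R d G). Qed.

Lemma msmooth_inv V (f : V -> G) x :
  msmooth f x -> msmooth (fun y => ginv (f y)) x.
Proof. exact: msmooth_map (@ginv_smooth R d G). Qed.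

(** The product in coordinates. The identity has coordinates [u0], which need not be 0, and formulas
    for the Lie algebra are Taylor coefficients at [(u0, u0)]. *)
Definition chart_mul (z : 'rV[R]_d * 'rV[R]_d) : 'rV[R]_d :=
  cG (gmul (beta z.1) (beta z.2)).

Lemma near_chart_target : \forall u \near u0, target cG u.
Proof. exact/near_target/source_target/chart_at_source. Qed.

Lemma msmooth_beta u : target cG u -> msmooth beta u.
Proof. exact/msmooth_param/chart_at_atlas. Qed.

Lemma smooth_chart_mul z : target cG z.1 -> target cG z.2 ->
  source cG (gmul (beta z.1) (beta z.2)) -> smooth_at chart_mul z.
Proof.
move=> t1 t2 s12; have fd := finite_dim_rV (R:=R) d.
have sm : msmooth (fun z : 'rV[R]_d * 'rV[R]_d => gmul (beta z.1) (beta z.2)) z.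
  apply: msmooth_mul.
    exact: msmooth_comp fd (smooth_at_fst z) (msmooth_beta t1).
  exact: msmooth_comp fd (smooth_at_snd z) (msmooth_beta t2).
exact: msmooth_coord sm (chart_at_atlas _) s12.
Qed.

Lemma smooth_chart_mul_l u : target cG u -> smooth_at chart_mul (u, u0).
Proof.
move=> tu; apply: smooth_chart_mul => //=.
  exact/source_target/chart_at_source.
by rewrite beta0 gmulg1; exact: source_param.
Qed.

Lemma smooth_chart_mul_r u : target cG u -> smooth_at chart_mul (u0, u).
Proof.
move=> tu; apply: smooth_chart_mul => //=.
  exact/source_target/chart_at_source.
by rewrite beta0 gmul1; exact: source_param.
Qed.

Lemma target0 : target cG u0.
Proof. exact/source_target/chart_at_source. Qed.

Lemma left_invariant_coord (Z : 'rV[R]_d) u : target cG u ->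
  field_coord cG (left_invariant_field (G := G) Z) u = 'd chart_mul (u, u0) (0, Z).
Proof.
move=> tu; have su := source_param tu.
rewrite /field_coord /left_invariant_field.
have sm : msmooth (fun w => gmul (beta u) (beta w)) u0.
  by apply: msmooth_mul; [exact: msmooth_cst|exact: msmooth_chart_param].
have Ev := tangent_map_vel_at Z beta0 (msmooth_chart_param _) sm.
rewrite vel_chart_param in Ev.
apply: etrans (congr1 (to_coord cG (x := beta u)) Ev) _.
have E1 : gmul (beta u) (beta u0) = beta u by rewrite beta0 gmulg1.
apply: etrans (to_coord_vel_at Z E1 sm (chart_at_atlas _) su) _.
have [d1 d2] := is_diff_pair_r u u0.
have d3 := smooth_at_differentiable (smooth_chart_mul_l tu).
by have := diff_comp_app Z d1 d3; rewrite d2.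
Qed.

Lemma left_invariant1 (X : 'rV[R]_d) : left_invariant_field (G := G) X (gone G) = X.
Proof.
rewrite /left_invariant_field /tangent_map gmul1.
apply: near_diff_id; apply: filterS near_chart_target => u tu /=.
by rewrite gmul1 paramK.
Qed.

(** The coordinate formula for the bracket of left invariant fields, with the first mixed derivative
    exchanged by Schwarz: both terms are then derivatives along [Z] of a derivative along [X], as
    they arise when [Ad (b(s)^-1) X] is differentiated in [s]. *)
Lemma lie_bracketE (X Z : 'rV[R]_d) :
  lie_bracket (G := G) X Z =
  'd (fun z => 'd chart_mul z (X, 0)) (u0, u0) (0, Z)
  - 'd (fun z => 'd chart_mul z (0, X)) (u0, u0) (Z, 0).
Proof.
have s0 := smooth_chart_mul_l target0.
have dE (Y W : 'rV[R]_d) : 'd (field_coord cG (left_invariant_field (G := G) Y)) u0 W =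
    'd (fun z => 'd chart_mul z (0, Y)) (u0, u0) (W, 0).
  have [d1 d2] := is_diff_pair_l u0 u0.
  have d3 := smooth_at_differentiable (smooth_at_diff (0, Y) s0).
  have E1 := diff_comp_app W d1 d3.
  rewrite d2 in E1; apply: etrans E1; apply: near_diff.
    by apply: filterS near_chart_target => u tu; rewrite left_invariant_coord.
  exact: (@differentiable_comp _ _ _ _ _ (fun z => 'd chart_mul z (0, Y)) _ d1 d3).
rewrite /lie_bracket /field_bracket !left_invariant1.
apply: etrans (f_equal2 (fun a b : 'rV[R]_d => a - b) (dE Z X) (dE X Z)) _.
congr (_ - _).
exact: schwarz (finite_dim_rV (R:=R) d) (s0 2).
Qed.

End LieGroups.

(** * Differentiating the adjoint action along a curve through the identity *)

Section Conjugation.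
Context {R : realType} {d : nat} {G : lie_group R d}.
Variables (exp : lie_algebra G -> G) (X Z : 'rV[R]_d).
Hypothesis expP : exponential_map exp.
Local Notation cG := (chart_at (gone G)).
Local Notation u0 := (cG (gone G)).
Local Notation beta := (param cG).
Local Notation plane := (R^o * R^o)%type.

Lemma exp_add (s t : R) : exp ((s + t) *: X) = gmul (exp (s *: X)) (exp (t *: X)).
Proof. by have [_ + _] := expP X; apply. Qed.

Lemma exp0 : exp (0 *: X) = gone G.
Proof.
have := exp_add 0 0; rewrite addr0 => /(congr1 (gmul (ginv (exp (0 *: X))))).
by rewrite gmulA gmulV gmul1.
Qed.

Lemma msmooth_exp (t : R^o) : msmooth (fun s : R^o => exp (s *: X)) t.
Proof. by have [es _ _] := expP X; exact: smooth_curve_msmooth. Qed.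

Lemma smooth_at_exp_coord : smooth_at (fun t : R^o => cG (exp (t *: X))) 0.
Proof.
apply: msmooth_coord (msmooth_exp 0) (chart_at_atlas _) _.
by rewrite exp0; exact: chart_at_source.
Qed.

Lemma diff_exp_coord : 'd (fun t : R^o => cG (exp (t *: X))) (0 : R^o) 1 = X.
Proof.
have [_ _ eX] := expP X.
by rewrite -derive1E' //; exact: (smooth_at_differentiable smooth_at_exp_coord).
Qed.

(** The curve [b] of velocity [Z], straight in the chart at the identity and in general not a
    one-parameter subgroup. It is meaningful only while [u0 + s *: Z] stays in the target of the
    chart. *)
Definition chart_ray (s : R) : G := beta (u0 + s *: Z).

Lemma chart_ray0 : chart_ray 0 = gone G.
Proof. by rewrite /chart_ray scale0r addr0 beta0. Qed.

Lemma near_chart_ray : \forall s \near (0 : R^o), target cG (u0 + s *: Z).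
Proof.
have c := smooth_at_continuous (smooth_at_line u0 Z (0 : R^o)).
have : \forall u \near u0 + (0 : R) *: Z, target cG u.
  by rewrite scale0r addr0; exact: near_chart_target.
exact: c.
Qed.

Definition exp_ray (q : plane) : G := gmul (exp (q.1 *: X)) (chart_ray q.2).

Definition conj_exp (q : plane) : G := gmul (ginv (chart_ray q.2)) (exp_ray q).

Lemma msmooth_chart_ray (q : plane) : target cG (u0 + q.2 *: Z) ->
  msmooth (fun q : plane => chart_ray q.2) q.
Proof.
move=> tq; apply: msmooth_comp (@finite_dim_regular R) (smooth_at_snd q) _.
exact: msmooth_comp (finite_dim_rV (R:=R) d) (smooth_at_line u0 Z q.2) (msmooth_beta tq).
Qed.

Lemma msmooth_exp_ray (q : plane) : target cG (u0 + q.2 *: Z) -> msmooth exp_ray q.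
Proof.
move=> tq; apply: msmooth_mul; last exact: msmooth_chart_ray.
exact: msmooth_comp (@finite_dim_regular R) (smooth_at_fst q) (msmooth_exp q.1).
Qed.

Lemma msmooth_conj_exp (q : plane) : target cG (u0 + q.2 *: Z) -> msmooth conj_exp q.
Proof.
move=> tq; apply: msmooth_mul; last exact: msmooth_exp_ray.
exact/msmooth_inv/msmooth_chart_ray.
Qed.

Lemma conj_exp0 (s : R) : conj_exp (0, s) = gone G.
Proof. by rewrite /conj_exp /exp_ray exp0 gmul1 gmulV. Qed.

(* This is [Ad (chart_ray s)^-1 X]. *)
Definition conj_velocity (s : R^o) : 'rV[R]_d :=
  vel (fun t : R^o => conj_exp (t, s)) (0 : R^o) 1.

Definition conj_coord (q : plane) : 'rV[R]_d := cG (conj_exp q).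

Lemma smooth_at_conj_coord (s : R) : target cG (u0 + s *: Z) ->
  smooth_at conj_coord (0, s).
Proof.
move=> ts; apply: msmooth_coord (chart_at_atlas _) _; first exact: (@msmooth_conj_exp (0, s)).
by rewrite conj_exp0; exact: chart_at_source.
Qed.

Lemma conj_velocityE (s : R) : target cG (u0 + s *: Z) ->
  conj_velocity s = 'd conj_coord (0, s) (1, 0).
Proof.
move=> ts; apply: etrans (velE_at (f := fun t : R^o => conj_exp (t, s)) (x := 0) 1 (conj_exp0 s)) _.
have [d1 d2] := is_diff_pair_l (s : R^o) (0 : R^o).
have d3 := smooth_at_differentiable (smooth_at_conj_coord ts).
have E := @diff_comp_app R R^o plane _ _ _ (0 : R^o) 1 d1 d3.
by rewrite d2 in E; exact: E.
Qed.

Lemma ray_target0 : target cG (u0 + (0 : R) *: Z).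
Proof. by rewrite scale0r addr0; exact: target0. Qed.

Lemma conj_velocity0 : conj_velocity 0 = X.
Proof.
apply: etrans (velE_at (f := fun t : R^o => conj_exp (t, 0)) (x := 0) 1 (conj_exp0 0)) _.
have -> : (fun t : R^o => cG (conj_exp (t, 0))) = (fun t : R^o => cG (exp (t *: X))).
  apply/funext => t; congr (cG _).
  by rewrite /conj_exp /exp_ray /= chart_ray0 !gmulg1 -[ginv _]gmulg1 gmulV gmul1.
exact: diff_exp_coord.
Qed.

Lemma smooth_conj_velocity : smooth_at conj_velocity 0.
Proof.
have s0 := smooth_at_diff ((1, 0) : plane) (smooth_at_conj_coord ray_target0).
apply: smooth_at_eq (smooth_at_comp finite_dim_plane (smooth_at_pair_r (0 : R^o) (0 : R^o)) s0).
by apply: filterS near_chart_ray => s ts; rewrite conj_velocityE.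
Qed.

(* Differentiate [chart_ray s * conj_exp (t, s) = exp (tX) * chart_ray s] in
   [t] at [0]. *)
Lemma conj_velocity_mul (s : R) : target cG (u0 + s *: Z) ->
  'd (chart_mul G) (u0 + s *: Z, u0) (0, conj_velocity s) =
  'd (chart_mul G) (u0, u0 + s *: Z) (X, 0).
Proof.
move=> ts; set us := u0 + s *: Z in ts *.
have dcE : conj_velocity s = 'd (fun t : R^o => conj_coord (t, s)) (0 : R^o) 1.
  exact: (velE_at (f := fun t : R^o => conj_exp (t, s)) (x := 0) 1 (conj_exp0 s)).
have cs : smooth_at (fun t : R^o => conj_coord (t, s)) 0.
  exact: smooth_at_comp finite_dim_plane (smooth_at_pair_l (s : R^o) (0 : R^o)) (smooth_at_conj_coord ts).
have dc := smooth_at_differentiable cs.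
have c00 : conj_coord (0, s) = u0 by rewrite /conj_coord conj_exp0.
have de := smooth_at_differentiable smooth_at_exp_coord.
have e00 : cG (exp (0 *: X)) = u0 by rewrite exp0.
have [dl1 dl2] := is_diff_pair (is_diff_cst us (0 : R^o)) (differentiableP dc).
have [dr1 dr2] := is_diff_pair (differentiableP de) (is_diff_cst us (0 : R^o)).
have ml : differentiable (chart_mul G) (us, conj_coord (0, s)).
  by rewrite c00; exact: smooth_at_differentiable (smooth_chart_mul_l ts).
have mr : differentiable (chart_mul G) (cG (exp (0 *: X)), us).
  by rewrite e00; exact: smooth_at_differentiable (smooth_chart_mul_r ts).
have dl3 : 'd (fun t : R^o => (us, conj_coord (t, s))) (0 : R^o) 1 = (0, conj_velocity s).
  by rewrite dcE; exact: (congr1 (fun F => F 1) dl2).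
have dr3 : 'd (fun t : R^o => (cG (exp (t *: X)), us)) (0 : R^o) 1 = (X, 0).
  by rewrite -[in RHS]diff_exp_coord; exact: (congr1 (fun F => F 1) dr2).
have El : 'd (fun t : R^o => chart_mul G (us, conj_coord (t, s))) (0 : R^o) 1 =
    'd (chart_mul G) (us, u0) (0, conj_velocity s).
  apply: etrans (diff_comp_app (1 : R^o) dl1 ml) _.
  apply: etrans (congr1 ('d (chart_mul G) (us, conj_coord (0, s))) dl3) _.
  exact: (congr1 (fun u => 'd (chart_mul G) (us, u) (0, conj_velocity s)) c00).
have Er : 'd (fun t : R^o => chart_mul G (cG (exp (t *: X)), us)) (0 : R^o) 1 =
    'd (chart_mul G) (u0, us) (X, 0).
  apply: etrans (diff_comp_app (1 : R^o) dr1 mr) _.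
  apply: etrans (congr1 ('d (chart_mul G) (cG (exp (0 *: X)), us)) dr3) _.
  exact: (congr1 (fun u => 'd (chart_mul G) (u, us) (X, 0)) e00).
apply: etrans (esym El) (etrans _ Er).
apply/esym/near_diff; last exact: (@differentiable_comp _ _ _ _ _ (chart_mul G) _ dl1 ml).
have n1 : \forall t \near (0 : R^o), source cG (conj_exp (t, s)).
  apply: near_source_comp; last by rewrite conj_exp0; exact: chart_at_source.
  have cq := smooth_at_continuous (smooth_at_pair_l (s : R^o) (0 : R^o)).
  exact: continuous_comp cq (@msmooth_conj_exp (0, s) ts).1.
have n2 : \forall t \near (0 : R^o), source cG (exp (t *: X)).
  apply: near_source_comp; last by rewrite exp0; exact: chart_at_source.
  exact: (msmooth_exp 0).1.
apply: filterS2 n1 n2 => t t1 t2.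
change (cG (gmul (beta us) (beta (cG (conj_exp (t, s))))) =
  cG (gmul (beta (cG (exp (t *: X)))) (beta us))).
rewrite (coordK t1) (coordK t2); congr (cG _).
by rewrite /conj_exp gmulA gmulgV gmul1.
Qed.

(** Left multiplication by the identity is the identity near [u0]. *)
Lemma diff_chart_mul_r (w : 'rV[R]_d) : 'd (chart_mul G) (u0, u0) (0, w) = w.
Proof.
have [d1 d2] := is_diff_pair_r u0 u0.
have d3 := smooth_at_differentiable (smooth_chart_mul_l (target0 G)).
have E := diff_comp_app w d1 d3.
have d2w := congr1 (fun F => F w) d2.
apply: etrans (esym (congr1 ('d (chart_mul G) (u0, u0)) d2w)) _.
apply: etrans (esym E) _.
apply: near_diff_id; apply: filterS (near_chart_target G) => u tu.
change (cG (gmul (beta u0) (beta u)) = u).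
by rewrite beta0 gmul1 paramK.
Qed.

(** Differentiate the identity [conj_velocity_mul] in [s] at 0. On the left the base point and the
    direction both move; the moving direction contributes the derivative sought, because [chart_mul]
    has identity differential in its second argument. The inverse in [Ad (b(s)^-1)] accounts for the
    order [[X, Z]]. *)
Lemma diff_conj_velocity : 'd conj_velocity (0 : R^o) 1 = lie_bracket (G := G) X Z.
Proof.
have fd := finite_dim_pair_rV (R:=R) (n:=d).
have s0 := smooth_chart_mul_l (target0 G).
have sl : smooth_at (chart_mul G) (u0 + (0 : R) *: Z, u0) by rewrite scale0r addr0.
have sr : smooth_at (chart_mul G) (u0, u0 + (0 : R) *: Z) by rewrite scale0r addr0.
have dv := differentiableP (smooth_at_differentiable smooth_conj_velocity).
have ql := is_diff_pair (is_diff_line u0 Z (0 : R^o)) (is_diff_cst u0 (0 : R^o)).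
have qr := is_diff_pair (is_diff_cst u0 (0 : R^o)) (is_diff_line u0 Z (0 : R^o)).
have wl := is_diff_pair (is_diff_cst (0 : 'rV[R]_d) (0 : R^o)) dv.
have wr := is_diff_cst ((X, 0) : 'rV[R]_d * 'rV[R]_d) (0 : R^o).
have El := diff_eval (1 : R^o) fd (sl 2) ql wl.
have Er := diff_eval (1 : R^o) fd (sr 2) qr wr.
have zE : u0 + (0 : R) *: Z = u0 by rewrite scale0r addr0.
have PhiE (u u' v v' w w' : 'rV[R]_d) : u = u' -> v = v' -> w = w' ->
    'd (fun z => 'd (chart_mul G) z (0, v)) (u, u0) (w, 0) =
    'd (fun z => 'd (chart_mul G) z (0, v')) (u', u0) (w', 0) by move=> -> -> ->.
have PsiE (u u' w w' : 'rV[R]_d) : u = u' -> w = w' ->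
    'd (fun z => 'd (chart_mul G) z (X, 0)) (u0, u) (0, w) =
    'd (fun z => 'd (chart_mul G) z (X, 0)) (u0, u') (0, w') by move=> -> ->.
have ThetaE (u u' w : 'rV[R]_d) : u = u' ->
    'd (chart_mul G) (u, u0) (0, w) = 'd (chart_mul G) (u', u0) (0, w) by move=> ->.
have lrE : 'd (fun y : R^o => 'd (chart_mul G) (u0 + y *: Z, u0) (0, conj_velocity y)) (0 : R^o) 1 =
    'd (fun y : R^o => 'd (chart_mul G) (u0, u0 + y *: Z) (X, 0)) (0 : R^o) 1.
  have [q1 _] := ql; have [w1 _] := wl.
  have [dl _] := is_diff_eval fd (sl 2) q1 w1.
  apply/esym/near_diff; last exact: dl.
  by apply: filterS near_chart_ray => s ts; exact: conj_velocity_mul ts.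
(* [A] and [C] are the second-derivative terms of the two sides, [B] the derivative sought, and [D]
   comes from the constant direction [(X, 0)], hence vanishes. *)
have alg (A B C D : 'rV[R]_d) : A + B = C + D -> D = 0 -> B = C - A.
  by move=> E D0; rewrite -[C]addr0 -D0 -E addrAC subrr add0r.
have B0 := etrans (ThetaE _ _ ('d conj_velocity (0 : R^o) 1) zE) (diff_chart_mul_r _).
apply: etrans (esym B0) _.
apply: etrans (alg _ _ _ _ (etrans (esym El) (etrans lrE Er)) _) _.
  exact: linear0.
apply: (etrans _ (esym (lie_bracketE G X Z))).
exact: (f_equal2 (fun a b : 'rV[R]_d => a - b) (PsiE _ _ _ _ zE (scale1r Z))
  (PhiE _ _ _ _ _ _ zE conj_velocity0 (scale1r Z))).
Qed.

End Conjugation.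

(** * Orbits of one-parameter subgroups *)

Section Orbit.
Context {R : realType} {d n : nat} {G : lie_group R d} {M : manifold R n}
  {F : finsler M}.
Variables (a : isometric_action G F) (p : M).
Variables (exp : lie_algebra G -> G) (X Z : 'rV[R]_d).
Hypothesis expP : exponential_map exp.
Local Notation E := ('rV[R]_n).
Local Notation cG := (chart_at (gone G)).
Local Notation u0 := (cG (gone G)).
Local Notation plane := (R^o * R^o)%type.
Local Notation target_ray s := (target cG (u0 + s *: Z)).
Local Notation et1 := ((1, 0) : plane).
Local Notation es1 := ((0, 1) : plane).

Lemma msmooth_orbit_param : msmooth (fun u => a (param cG u) p) u0.
Proof. by apply: msmooth_act; [exact: msmooth_chart_param|exact: msmooth_cst]. Qed.

Lemma dpi_vel (V : normedModType R) (g : V -> G) v h : g v = gone G -> msmooth g v ->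
  dpi a p (vel g v h) = vel (fun y => a (g y) p) v h.
Proof.
move=> gv gs.
exact: (@tangent_map_vel_at _ V _ _ _ _ (fun b => a b p) g v h _ gv gs msmooth_orbit_param).
Qed.

Lemma dpiD (u v : 'rV[R]_d) : dpi a p (u + v) = dpi a p u + dpi a p v.
Proof. exact: linearD. Qed.

Lemma dpiZ k (u : 'rV[R]_d) : dpi a p (k *: u) = k *: dpi a p u.
Proof. exact: linearZ. Qed.

Lemma diff_dpi (V : normedModType R) (f : V -> 'rV[R]_d) x : differentiable f x ->
  is_diff x (fun y => dpi a p (f y) : E) (fun v => dpi a p ('d f x v)).
Proof.
move=> df.
have dc := smooth_at_differentiable (msmooth_coord_at msmooth_orbit_param).
have cl := diff_continuous dc.
pose D (y : 'rV[R]_d) := chart_at (a (param cG u0) p) (a (param cG y) p).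
have E1 : (fun v => dpi a p v : E) = 'd D u0.
  by apply/funext => v; rewrite /dpi /tangent_map /D beta0.
have E2 : (fun y => dpi a p (f y) : E) = (fun y => 'd D u0 (f y)).
  by apply/funext => y; exact: (congr1 (fun h => h (f y)) E1).
have E3 : (fun y => dpi a p ('d f x y) : E) = (fun y => 'd D u0 ('d f x y)).
  by apply/funext => y; exact: (congr1 (fun h => h ('d f x y)) E1).
rewrite E2 E3; apply: DiffDef.
  exact: (@differentiable_comp _ _ _ _ f _ _ df (linear_differentiable (f x) cl)).
by apply/funext => v; exact: diff_lincomp.
Qed.

Definition orbit_map (q : plane) : M := a (exp_ray exp X Z q) p.

Lemma orbit_exp (t : R) : orbit_map (t, 0) = a (exp (t *: X)) p.
Proof. by rewrite /orbit_map /exp_ray chart_ray0 gmulg1. Qed.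

Lemma msmooth_orbit (q : plane) : target_ray q.2 -> msmooth orbit_map q.
Proof.
by move=> tq; apply: msmooth_act; [exact: msmooth_exp_ray|exact: msmooth_cst].
Qed.

Lemma orbit_shift (t0 : R) (q : plane) : orbit_map (q + (t0, 0)) = a (exp (t0 *: X)) (orbit_map q).
Proof.
rewrite /orbit_map /exp_ray -!actM /= addr0 [q.1 + t0]addrC (exp_add X expP).
by rewrite gmulA.
Qed.

Lemma vel_orbit_shift (t0 s : R) h : target_ray s ->
  vel orbit_map (t0, s) h = vel (fun q => a (exp (t0 *: X)) (orbit_map q)) (0, s) h.
Proof.
move=> ts.
have q0 : ((0, s) : plane) + (t0, 0) = (t0, s).
  by apply: injective_projections; rewrite /= ?add0r ?addr0.
have [d1 d2] : is_diff ((0, s) : plane) (fun q => q + (t0, 0)) id.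
  have := @is_diffD _ _ _ _ _ _ _ ((0, s) : plane) (is_diff_id _) (is_diff_cst ((t0, 0) : plane) _).
  by rewrite addr0.
have so : msmooth orbit_map (((0, s) : plane) + (t0, 0)) by rewrite q0; exact: msmooth_orbit.
have E1 := @vel_comp _ plane plane _ _ orbit_map (fun q : plane => q + (t0, 0)) (0, s) h so d1.
rewrite -[LHS]/(vel orbit_map (t0, s) h) -q0.
apply: etrans (congr1 (fun L => vel orbit_map _ (L h)) (esym d2)) _.
apply: etrans (esym E1) _.
have E2 : (fun q : plane => orbit_map (q + (t0, 0))) = (fun q => a (exp (t0 *: X)) (orbit_map q)).
  by apply/funext => q; exact: orbit_shift.
exact: (congr1 (fun f => vel f ((0, s) : plane) h) E2).
Qed.

(** A translation in [t] is the action of the isometry [exp (t0 X)]. The direction [h] is kept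
    general: [(1, 0)] serves the derivative in [s], and [(1, e)] the vertical derivative. *)
Lemma metric_orbit_shift (t0 s : R) h : target_ray s ->
  F (orbit_map (t0, s)) (vel orbit_map (t0, s) h) = F (orbit_map (0, s)) (vel orbit_map (0, s) h).
Proof.
move=> ts.
have q0 : ((0, s) : plane) + (t0, 0) = (t0, s).
  by apply: injective_projections; rewrite /= ?add0r ?addr0.
have oE : orbit_map (t0, s) = a (exp (t0 *: X)) (orbit_map (0, s)).
  by rewrite -q0; exact: orbit_shift.
have E1 := vel_orbit_shift t0 h ts.
have E2 := metric_act a (exp (t0 *: X)) h (@msmooth_orbit (0, s) ts).
apply: etrans (congr1 (fun v : E => F (orbit_map (t0, s)) v) E1) _.
exact: etrans (congr1 (fun x => F x _) oE) E2.
Qed.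

(** Write [exp(tX) b(s) p] as [b(s)] applied to [(b(s)^-1 exp(tX) b(s)) p]. For fixed [s] the
    isometry [b(s)] drops out, and the remaining curve in [G] passes through the identity at
    [t = 0]. *)
Lemma metric_orbit_conj (s : R) : target_ray s ->
  F (orbit_map (0, s)) (vel orbit_map (0, s) et1) = F p (dpi a p (conj_velocity exp X Z s)).
Proof.
move=> ts.
have [d1 d2] := is_diff_pair_l (s : R^o) (0 : R^o).
have so : msmooth orbit_map (0, s) by exact: msmooth_orbit.
have E1 := @vel_comp _ R^o plane _ _ orbit_map (fun t : R^o => (t, s)) (0 : R^o) 1 so d1.
have -> : vel orbit_map (0, s) et1 = vel (fun t : R^o => orbit_map (t, s)) (0 : R^o) 1.
  by apply/esym; apply: etrans E1 _; exact: (congr1 (fun L => vel orbit_map (0, s) (L 1)) d2).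
have oE : (fun t : R^o => orbit_map (t, s)) =
    (fun t => a (chart_ray Z s) (a (conj_exp exp X Z (t, s)) p)).
  by apply/funext => t; rewrite -actM /conj_exp gmulA gmulgV gmul1.
have sc : msmooth (fun t : R^o => conj_exp exp X Z (t, s)) 0.
  exact: msmooth_comp finite_dim_plane (smooth_at_pair_l (s : R^o) (0 : R^o))
    (@msmooth_conj_exp _ _ _ _ X Z expP (0, s) ts).
have sa : msmooth (fun t : R^o => a (conj_exp exp X Z (t, s)) p) 0.
  by apply: msmooth_act => //; exact: msmooth_cst.
rewrite oE -[orbit_map (0, s)]/((fun t : R^o => orbit_map (t, s)) 0) oE metric_act //.
rewrite (conj_exp0 X Z expP) act1; congr (F p _).
by rewrite -dpi_vel // (conj_exp0 X Z expP).
Qed.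

(** By linearity only the two axes matter, along which the map is [exp(tX)] and [b(s)]
    respectively. *)
Lemma vel_exp_ray (k e : R) :
  vel (exp_ray exp X Z) ((0, 0) : plane) ((k, e) : plane) = k *: X + e *: Z.
Proof.
have g0 : exp_ray exp X Z (0, 0) = gone G.
  by rewrite /exp_ray /= (exp0 X expP) gmul1 chart_ray0.
apply: etrans (velE_at _ g0) _.
have sr := @msmooth_exp_ray _ _ _ _ X Z expP (0, 0) (ray_target0 Z).
have ss : smooth_at (fun q => cG (exp_ray exp X Z q)) (0, 0).
  by apply: msmooth_coord sr (chart_at_atlas _) _; rewrite g0; exact: chart_at_source.
have ds := smooth_at_differentiable ss.
have -> : ((k, e) : plane) = k *: et1 + e *: es1.
  apply: injective_projections; rewrite /= ?scaler0 ?addr0 ?add0r.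
    by rewrite [_ *: _]mulr1.
  by rewrite [_ *: _]mulr1.
have Et : 'd (fun q => cG (exp_ray exp X Z q)) (0, 0) et1 = X.
  have [d1 d2] := is_diff_pair_l (0 : R^o) (0 : R^o).
  have E1 := @diff_comp_app R R^o plane _ _ _ (0 : R^o) 1 d1 ds.
  apply: etrans (congr1 (fun L => 'd (fun q => cG (exp_ray exp X Z q)) (0, 0) (L 1)) (esym d2)) _.
  apply: etrans (esym E1) _.
  have fE : (fun t : R^o => cG (exp_ray exp X Z (t, 0))) = (fun t : R^o => cG (exp (t *: X))).
    by apply/funext => t; rewrite /exp_ray /= chart_ray0 gmulg1.
  exact: etrans (congr1 (fun f => 'd f (0 : R^o) 1) fE) (diff_exp_coord X expP).
have Es : 'd (fun q => cG (exp_ray exp X Z q)) (0, 0) es1 = Z.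
  have [d1 d2] := is_diff_pair_r (0 : R^o) (0 : R^o).
  have E1 := @diff_comp_app R R^o plane _ _ _ (0 : R^o) 1 d1 ds.
  apply: etrans (congr1 (fun L => 'd (fun q => cG (exp_ray exp X Z q)) (0, 0) (L 1)) (esym d2)) _.
  apply: etrans (esym E1) _.
  have [d3 d4] := is_diff_line u0 Z (0 : R^o).
  apply: etrans (etrans (congr1 (fun L => L 1) d4) (scale1r Z)).
  apply: near_diff d3.
  apply: filterS (@near_chart_ray R d G Z) => s ts.
  apply/esym; change (cG (gmul (exp (0 *: X)) (chart_ray Z s)) = u0 + s *: Z).
  by rewrite (exp0 X expP) gmul1; exact: paramK ts.
apply: etrans (linearD _ _ _) _.
by rewrite !linearZ /= Et Es.
Qed.

Lemma orbit00 : orbit_map (0, 0) = p.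
Proof. by rewrite orbit_exp (exp0 X expP) act1. Qed.

Lemma vel_orbit0 (k e : R) :
  vel orbit_map ((0, 0) : plane) ((k, e) : plane) = k *: dpi a p X + e *: dpi a p Z.
Proof.
have g0 : exp_ray exp X Z (0, 0) = gone G.
  by rewrite /exp_ray /= (exp0 X expP) gmul1 chart_ray0.
have sr := @msmooth_exp_ray _ _ _ _ X Z expP (0, 0) (ray_target0 Z).
by rewrite -dpi_vel // vel_exp_ray dpiD !dpiZ.
Qed.

End Orbit.

(** * The Euler-Lagrange expression along an orbit *)

Section OrbitEulerLagrange.
Context {R : realType} {d n : nat} {G : lie_group R d} {M : manifold R n}
  {F : finsler M}.
Variables (a : isometric_action G F) (p : M).
Variables (exp : lie_algebra G -> G) (X Z : 'rV[R]_d).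
Hypothesis expP : exponential_map exp.
Local Notation E := ('rV[R]_n).
Local Notation plane := (R^o * R^o)%type.
Local Notation et1 := ((1, 0) : plane).
Local Notation es1 := ((0, 1) : plane).
Local Notation orb := (orbit_map a p exp X Z).
Variables (c : chart R n M) (t0 : R).
Hypotheses (ac : atlas c) (sc : source c (orb (t0, 0))).
Local Notation q0 := ((t0, 0) : plane).
Local Notation sqF := (fun w : E => F p w ^+ 2 : R^o).

Definition orbit_coord (q : plane) : E := c (orb q).
Local Notation xh := orbit_coord.

(** The point [(x, x_t)] of the tangent bundle, read in the chart [c]. *)
Definition orbit_jet (q : plane) : E * E := (xh q, 'd xh q et1).

Lemma smooth_orbit_coord : smooth_at xh q0.
Proof. exact: msmooth_coord (@msmooth_orbit _ _ _ _ _ _ a p exp X Z expP q0 (ray_target0 Z)) ac sc. Qed.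

Lemma smooth_orbit_jet : smooth_at orbit_jet q0.
Proof. exact: smooth_at_pair smooth_orbit_coord (smooth_at_diff et1 smooth_orbit_coord). Qed.

Lemma energy_orbit (q h : plane) : target (chart_at (gone G)) (chart_at (gone G) (gone G) + q.2 *: Z) ->
  source c (orb q) -> energy F c (xh q, 'd xh q h) = F (orb q) (vel orb q h) ^+ 2.
Proof.
move=> tq sq; rewrite /energy; congr (_ ^+ 2).
exact: metric_coord_vel (@msmooth_orbit _ _ _ _ _ _ a p exp X Z expP q tq) ac sq.
Qed.

Lemma energy_orbit_s : \forall s \near (0 : R^o),
  energy F c (orbit_jet (t0, s)) = sqF (dpi a p (conj_velocity exp X Z s)).
Proof.
have cont : {for (0 : R^o), continuous (fun s : R^o => orb (t0, s))}.
  have so := (@msmooth_orbit _ _ _ _ _ _ a p exp X Z expP q0 (ray_target0 Z)).1.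
  exact: continuous_comp (smooth_at_continuous (smooth_at_pair_r (t0 : R^o) (0 : R^o))) so.
have ns := near_source_comp cont sc.
apply: filterS2 (@near_chart_ray R d G Z) ns => s ts ss.
apply: etrans (@energy_orbit (t0, s) et1 ts ss) _.
by rewrite metric_orbit_shift // metric_orbit_conj.
Qed.

Hypothesis xt0 : 'd xh q0 et1 != 0.
Hypothesis dX0 : dpi a p X != 0.

Lemma smooth_energy_jet : smooth_at (energy F c) (orbit_jet q0).
Proof. by apply: smooth_at_energy => //; exact: source_target. Qed.

(** By [energy_orbit_s] the energy of the jet is, near [s = 0], a function of
    [dpi (Ad (b(s)^-1) X)]; its derivative therefore comes from [diff_conj_velocity]. *)
Lemma diff_energy_s :
  'd (energy F c) (orbit_jet q0) ('d xh q0 es1, 'd (fun q => 'd xh q et1) q0 es1) =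
  'd sqF (dpi a p X) (dpi a p (lie_bracket (G := G) X Z)).
Proof.
have dL := smooth_at_differentiable smooth_energy_jet.
have [ds1 ds2] := is_diff_pair_r (t0 : R^o) (0 : R^o).
have dj := smooth_at_differentiable smooth_orbit_jet.
have dx := smooth_at_differentiable smooth_orbit_coord.
have dxt := smooth_at_differentiable (smooth_at_diff et1 smooth_orbit_coord).
have [_ djE] := is_diff_pair (differentiableP dx) (differentiableP dxt).
have E1 := @diff_comp_app R R^o plane _ _ _ (0 : R^o) 1 ds1 dj.
have dj' := @differentiable_comp _ _ _ _ (fun s : R^o => (t0, s)) orbit_jet (0 : R^o) ds1 dj.
have E2 := @diff_comp_app R R^o _ _ _ (energy F c) (0 : R^o) 1 dj' dL.
have dl := @differentiable_comp _ _ _ _ (fun s : R^o => orbit_jet (t0, s)) (energy F c) (0 : R^o) dj' dL.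
have dA := smooth_at_differentiable (smooth_conj_velocity X Z expP).
have [dp1 dp2] := diff_dpi a p dA.
have dF := differentiable_sqr_metric F p dX0.
have dF' : differentiable sqF (dpi a p (conj_velocity exp X Z 0)).
  by rewrite (conj_velocity0 X Z expP).
have E3 := @diff_comp_app R R^o _ _ _ _ (0 : R^o) 1 dp1 dF'.
have E4 := near_diff (1 : R^o) energy_orbit_s dl.
have J0 : 'd (fun s : R^o => orbit_jet (t0, s)) (0 : R^o) 1 =
    ('d xh q0 es1, 'd (fun q => 'd xh q et1) q0 es1).
  apply: etrans E1 _.
  apply: etrans (congr1 (fun L => 'd orbit_jet q0 (L 1)) ds2) _.
  exact: (congr1 (fun L => L es1) djE).
apply: etrans (congr1 ('d (energy F c) (orbit_jet q0)) (esym J0)) _.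
apply: etrans (esym E2) _.
apply: etrans (esym E4) _.
apply: etrans E3 _.
apply: etrans (congr1 (fun L => 'd sqF (dpi a p (conj_velocity exp X Z 0)) (L 1)) dp2) _.
have c0 := conj_velocity0 X Z expP.
have cd := diff_conj_velocity X Z expP.
apply: etrans (congr1 (fun v => 'd sqF (dpi a p (conj_velocity exp X Z 0)) (dpi a p v)) cd) _.
exact: (congr1 (fun v => 'd sqF (dpi a p v) (dpi a p _)) c0).
Qed.

(** Both sides are derivatives at [e = 0] of the same function: the velocity of the orbit map in
    direction [(1, e)] has the same length at [(t,0)] as at [(0,0)], where it is [X_m + e Z_m]. The
    equality is needed for all [t] near [t0], since it will be differentiated in [t]. *)
Lemma diff_energy_vertical : \forall t \near (t0 : R^o),
  'd (energy F c) (orbit_jet (t, 0)) (0, 'd xh (t, 0) es1) =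
  'd sqF (dpi a p X) (dpi a p Z).
Proof.
have cl := smooth_at_continuous (smooth_at_pair_l (0 : R^o) (t0 : R^o)).
have so := (@msmooth_orbit _ _ _ _ _ _ a p exp X Z expP q0 (ray_target0 Z)).1.
have n1 : \forall t \near (t0 : R^o), source c (orb (t, 0)).
  have cont : {for (t0 : R^o), continuous (fun t : R^o => orb (t, 0))}.
    exact: continuous_comp cl so.
  exact: near_source_comp cont sc.
have n2 : \forall t \near (t0 : R^o), 'd xh (t, 0) et1 != 0.
  have cx := smooth_at_continuous (smooth_at_diff et1 smooth_orbit_coord).
  have cc := @continuous_comp _ _ _ (fun t : R^o => (t, 0)) (fun q => 'd xh q et1) (t0 : R^o) cl cx.
  exact: cvgr_neq0 cc xt0.
apply: filterS2 n1 n2 => t st nt.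
have dL : differentiable (energy F c) (orbit_jet (t, 0)).
  by apply/smooth_at_differentiable/smooth_at_energy => //; exact: source_target.
have dF := differentiable_sqr_metric F p dX0.
apply: etrans (esym (derive1_line (0, 'd xh (t, 0) es1) dL)) _.
apply: etrans (derive1_line (dpi a p Z) dF).
congr (derive1 _ 0); apply/funext => e.
have -> : orbit_jet (t, 0) + e *: (0, 'd xh (t, 0) es1) =
    (xh (t, 0), 'd xh (t, 0) ((1, e) : plane)).
  have -> : ((1, e) : plane) = et1 + e *: es1.
    by apply: injective_projections; rewrite /= ?scaler0 ?addr0 ?add0r ?[_ *: _]mulr1.
  apply: injective_projections; first by rewrite /= scaler0 addr0.
  by apply/esym/(etrans (linearD _ _ _)); rewrite linearZ.
apply: etrans (@energy_orbit (t, 0) (1, e) (ray_target0 Z) st) _.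
rewrite metric_orbit_shift //; last exact: ray_target0.
by rewrite orbit00 // vel_orbit0 // scale1r.
Qed.

Lemma orbit_euler_lagrange :
  'd (fun z => 'd (energy F c) z (0, 'd xh q0 es1)) (orbit_jet q0)
    ('d xh q0 et1, 'd (fun q => 'd xh q et1) q0 et1)
  - 'd (energy F c) (orbit_jet q0) ('d xh q0 es1, 0) =
  - 'd sqF (dpi a p X) (dpi a p (lie_bracket (G := G) X Z)).
Proof.
have fd := finite_dim_pair_rV (R:=R) (n:=n).
have [ds1 ds2] := is_diff_pair_l (0 : R^o) (t0 : R^o).
have dj := smooth_at_differentiable smooth_orbit_jet.
have dx := smooth_at_differentiable smooth_orbit_coord.
have dxt := smooth_at_differentiable (smooth_at_diff et1 smooth_orbit_coord).
have dxs := smooth_at_differentiable (smooth_at_diff es1 smooth_orbit_coord).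
have [_ djE] := is_diff_pair (differentiableP dx) (differentiableP dxt).
have iq : is_diff (t0 : R^o) (fun t : R^o => orbit_jet (t, 0)) (fun h => 'd orbit_jet q0 (h, 0)).
  apply: DiffDef; first exact: (@differentiable_comp _ _ _ _ (fun t : R^o => (t, 0)) orbit_jet).
  apply/funext => h; apply: etrans (@diff_comp_app R R^o plane _ _ _ (t0 : R^o) h ds1 dj) _.
  exact: (congr1 (fun L => 'd orbit_jet q0 (L h)) ds2).
have ix : is_diff (t0 : R^o) (fun t : R^o => 'd xh (t, 0) es1) (fun h => 'd (fun q => 'd xh q es1) q0 (h, 0)).
  apply: DiffDef; first exact: (@differentiable_comp _ _ _ _ (fun t : R^o => (t, 0)) (fun q => 'd xh q es1)).
  apply/funext => h; apply: etrans (@diff_comp_app R R^o plane _ _ _ (t0 : R^o) h ds1 dxs) _.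
  exact: (congr1 (fun L => 'd (fun q => 'd xh q es1) q0 (L h)) ds2).
have iw := is_diff_pair (is_diff_cst (0 : E) (t0 : R^o)) ix.
have E1 := diff_eval (1 : R^o) fd (smooth_energy_jet 2) iq iw.
have E0 : 'd (fun t : R^o => 'd (energy F c) (orbit_jet (t, 0)) (0, 'd xh (t, 0) es1)) (t0 : R^o) 1 = 0.
  have nE : \forall t \near (t0 : R^o), cst ('d sqF (dpi a p X) (dpi a p Z)) t =
     'd (energy F c) (orbit_jet (t, 0)) (0, 'd xh (t, 0) es1).
    by apply: filterS diff_energy_vertical => t; exact: esym.
  apply: etrans (near_diff (1 : R^o) nE (differentiable_cst _ _)) _.
  exact: (congr1 (fun L : R^o -> R^o => L 1) (diff_cst ('d sqF (dpi a p X) (dpi a p Z) : R^o) (t0 : R^o))).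
have J1 : 'd orbit_jet q0 et1 = ('d xh q0 et1, 'd (fun q => 'd xh q et1) q0 et1).
  exact: (congr1 (fun L => L et1) djE).
(* The equality of [x_ts] and [x_st] is what lets the mixed terms of the two derivatives cancel. *)
have S := schwarz es1 et1 (finite_dim_rV (R:=R) n) (smooth_orbit_coord 2).
have D := diff_energy_s.
have D2 := pair_lin ('d (energy F c) (orbit_jet q0)) ('d xh q0 es1) ('d (fun q => 'd xh q et1) q0 es1).
(* [A + C] is the [t]-derivative of the constant vertical derivative, [T = B + C] the [s]-derivative
   of the energy, [C] the common mixed term, and [K] the value of [T] through the bracket. *)
have alg (A B C K T : R^o) : A + C = 0 -> T = K -> T = B + C -> A - B = - K.
  move=> /eqP; rewrite addr_eq0 => /eqP -> <- ->; by rewrite opprD addrC.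
apply: alg (etrans (esym _) (etrans (esym E1) E0)) D D2.
apply: f_equal2.
  exact: (congr1 ('d (fun z => 'd (energy F c) z (0, 'd xh q0 es1)) (orbit_jet q0)) J1).
exact: (congr1 (fun v => 'd (energy F c) (orbit_jet q0) (0, v)) S).
Qed.

End OrbitEulerLagrange.

(** * Geodesic vectors *)

Section GeodesicVectors.
Context {R : realType} {d n : nat} {G : lie_group R d} {M : manifold R n}
  {F : finsler M}.
Variables (a : isometric_action G F) (p : M).
Variable exp : lie_algebra G -> G.
Hypothesis expP : exponential_map exp.
Local Notation E := ('rV[R]_n).
Local Notation plane := (R^o * R^o)%type.
Local Notation et1 := ((1, 0) : plane).
Local Notation es1 := ((0, 1) : plane).

(** The chain rule for [a b' \o a b = id]: the differentials of the action are invertible, with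
    explicit inverse. *)
Lemma tangent_map_actK (b b' : G) (x y : M) (v : E) :
  gmul b' b = gone G -> a b x = y ->
  tangent_map (a b') (x := y) (tangent_map (a b) (x := x) v) = v.
Proof.
move=> bb xy; have sx := msmooth_chart_param x.
have sact (b0 : G) (y0 : M) : msmooth (fun u => a b0 (param (chart_at y0) u)) (chart_at y0 y0).
  by apply: msmooth_act; [exact: msmooth_cst|exact: msmooth_chart_param].
have px : param (chart_at x) (chart_at x x) = x by rewrite coordK //; exact: chart_at_source.
have E1 := tangent_map_vel_at v px sx (sact b x).
rewrite vel_chart_param in E1.
apply: etrans (congr1 (fun w : E => tangent_map (a b') (x := y) w) E1) _.
have py : a b (param (chart_at x) (chart_at x x)) = y by rewrite px.
have E2 := @tangent_map_vel_at _ _ _ _ _ _ (a b')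
  (fun u => a b (param (chart_at x) u)) _ v _ py (sact b x) (sact b' y).
apply: etrans E2 _.
have E3 : (fun u => a b' (a b (param (chart_at x) u))) = param (chart_at x).
  by apply/funext => u; rewrite -actM bb act1.
apply: etrans (congr1 (fun f => vel f (chart_at x x) v) E3) _.
exact: vel_chart_param.
Qed.

(** [dpi Y] is the velocity of the orbit of [p] under [exp(tY)], which is constant. *)
Lemma dpi_isotropy (Y : 'rV[R]_d) : isotropy_algebra a p exp Y -> dpi a p Y = 0.
Proof.
move=> iY.
have vY : vel (fun t : R^o => exp (t *: Y)) (0 : R^o) 1 = Y.
  apply: etrans (@velE_at _ R^o _ _ (fun t : R^o => exp (t *: Y)) (0 : R^o) 1 _ (exp0 Y expP)) _.
  exact: diff_exp_coord.
have E1 := dpi_vel a p (1 : R^o) (exp0 Y expP) (msmooth_exp Y expP 0).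
rewrite vY in E1; apply: etrans E1 _.
have E2 : (fun t : R^o => a (exp (t *: Y)) p) = cst p by apply/funext => t; exact: iY.
apply: etrans (congr1 (fun f => vel f (0 : R^o) 1) E2) _.
exact: (congr1 (fun L : R^o -> E => L 1) (diff_cst (chart_at p p) (0 : R^o))).
Qed.

(** The [h]-component is killed by [dpi], so the scalar product on [m] can be evaluated on
    unprojected vectors. *)
Lemma dpi_reductive (m h : {vspace 'rV[R]_d}) (Y : 'rV[R]_d) :
  reductive_decomposition a p exp m h -> dpi a p (daddv_pi m h Y) = dpi a p Y.
Proof.
move=> [hP mh mh0 _].
have yE : daddv_pi m h Y + daddv_pi h m Y = Y.
  by apply: daddv_pi_add => //; rewrite mh memvf.
rewrite -[in RHS]yE dpiD [X in _ + X]dpi_isotropy ?addr0 //.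
exact/hP/memv_pi.
Qed.

Variable X : 'rV[R]_d.
Local Notation sigma := (fun t : R => a (exp (t *: X)) p).

Lemma msmooth_sigma (t : R^o) : msmooth (fun t : R^o => sigma t) t.
Proof. by apply: msmooth_act; [exact: msmooth_exp|exact: msmooth_cst]. Qed.

Lemma vel_orbit_map (Z : 'rV[R]_d) (t k e : R) :
  vel (orbit_map a p exp X Z) ((t, 0) : plane) ((k, e) : plane) =
  tangent_map (a (exp (t *: X))) (x := p) (k *: dpi a p X + e *: dpi a p Z).
Proof.
have E1 := vel_orbit_shift a p X expP t ((k, e) : plane) (ray_target0 Z).
apply: etrans E1 _.
rewrite -(vel_orbit0 a p X Z expP); apply/esym.
apply: tangent_map_vel_at; first exact: orbit00.
  exact: (@msmooth_orbit _ _ _ _ _ _ a p exp X Z expP (0, 0) (ray_target0 Z)).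
by apply: msmooth_act; [exact: msmooth_cst|exact: msmooth_chart_param].
Qed.

Lemma diff_orbit_coord c t Z (k e : R) : atlas c -> source c (sigma t) ->
  'd (orbit_coord a p exp X Z c) (t, 0) ((k, e) : plane) =
  to_coord c (x := sigma t) (tangent_map (a (exp (t *: X))) (x := p) (k *: dpi a p X + e *: dpi a p Z)).
Proof.
move=> ac sc; rewrite -vel_orbit_map; apply/esym/to_coord_vel_at => //; first exact: orbit_exp.
exact: (@msmooth_orbit _ _ _ _ _ _ a p exp X Z expP (t, 0) (ray_target0 Z)).
Qed.

Section AtChart.
Variables (c : chart R n M) (t : R).
Hypotheses (ac : atlas c) (sc : source c (sigma t)).
Local Notation T := (derive1 (c \o sigma)).
Local Notation xh Z := (orbit_coord a p exp X Z c).

Lemma source_orbit_map Z : source c (orbit_map a p exp X Z (t, 0)).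
Proof. by rewrite orbit_exp. Qed.

(** On [s = 0] the orbit map restricts to the orbit for every [Z], so [Z] stays free. The equality
    holds near [t] in order to be differentiated once more. *)
Lemma velocity_sigma Z : \forall s \near (t : R^o), T s = 'd (xh Z) (s, 0) et1.
Proof.
have ns : \forall s \near (t : R^o), source c (sigma s).
  exact: near_source_comp (msmooth_sigma t).1 sc.
apply: filterS ns => s ss.
have dx : differentiable (xh Z) (s, 0).
  apply/smooth_at_differentiable/smooth_orbit_coord => //.
  by rewrite orbit_exp.
have xE : c \o sigma = (fun r : R^o => xh Z (r, 0)).
  by apply/funext => r; rewrite /orbit_coord orbit_exp.
have [d1 d2] := is_diff_pair_l (0 : R^o) (s : R^o).
have dxs := @differentiable_comp _ _ _ _ (fun r : R^o => (r, 0)) (xh Z) (s : R^o) d1 dx.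
rewrite xE; apply: etrans (@derive1E' _ _ _ (s : R^o) dxs) _.
apply: etrans (@diff_comp_app R R^o plane _ _ _ (s : R^o) 1 d1 dx) _.
exact: (congr1 (fun L => 'd (xh Z) (s, 0) (L 1)) d2).
Qed.

Lemma acceleration_sigma Z : derive1 T t = 'd (fun q => 'd (xh Z) q et1) (t, 0) et1.
Proof.
have sx := smooth_at_diff et1 (smooth_orbit_coord expP ac (source_orbit_map Z)).
have dx := smooth_at_differentiable sx.
have [d1 d2] := is_diff_pair_l (0 : R^o) (t : R^o).
have dxs := @differentiable_comp _ _ _ _ (fun r : R^o => (r, 0)) (fun q => 'd (xh Z) q et1) (t : R^o) d1 dx.
rewrite derive1E; apply: etrans (near_eq_derive _ (velocity_sigma Z)) _.
apply: etrans (deriveE _ dxs) _.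
apply: etrans (@diff_comp_app R R^o plane _ _ _ (t : R^o) 1 d1 dx) _.
exact: (congr1 (fun L => 'd (fun q => 'd (xh Z) q et1) (t, 0) (L 1)) d2).
Qed.

Lemma orbit_jetE Z : orbit_jet a p exp X Z c (t, 0) = (c (sigma t), T t).
Proof.
rewrite /orbit_jet (nbhs_singleton (velocity_sigma Z)).
by rewrite /orbit_coord orbit_exp.
Qed.

(** The velocity at time [t] is the image of [X_m] under the invertible differential of [exp(tX)].
    The variation with [Z = 0] is an arbitrary choice. *)
Lemma velocity_sigma_neq0 : dpi a p X != 0 -> T t != 0.
Proof.
apply: contra_neq; rewrite (nbhs_singleton (velocity_sigma 0)) => T0.
have so := @msmooth_orbit _ _ _ _ _ _ a p exp X 0 expP (t, 0) (ray_target0 0).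
have E1 := of_coord_vel et1 so ac (source_orbit_map 0).
have v0 : vel (orbit_map a p exp X 0) ((t, 0) : plane) et1 = 0.
  apply: etrans (esym E1) _.
  by apply: etrans (congr1 (fun w : E => of_coord c _ w) T0) _; exact: linear0.
rewrite vel_orbit_map scale1r scale0r addr0 in v0.
have E2 := @tangent_map_actK (exp (t *: X)) (ginv (exp (t *: X))) p _ (dpi a p X) (gmulV _) erefl.
rewrite -E2 v0; exact: linear0.
Qed.

(** At [(t,0)], [x_s] is the image of [dpi Z] under the differential of [exp(tX)]. Pull [w] back to
    [p] by the inverse isometry and lift it to the Lie algebra, as the projection is a
    submersion. *)
Lemma orbit_coord_surjective (a_homogeneous : homogeneous_space a p) (w : E) :
  exists Z, 'd (xh Z) (t, 0) es1 = w.
Proof.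
have [_ hsurj] := a_homogeneous.
pose y : E := of_coord c (c (sigma t)) w.
pose b := exp (t *: X).
(* Here [tangent p] is read as [tangent (a (gone G) p)]. *)
have [Z ZE] := hsurj (gone G) (tangent_map (a (ginv b)) (x := sigma t) y).
exists Z; rewrite diff_orbit_coord // scale0r add0r scale1r.
have -> : dpi a p Z = tangent_map (a (ginv b)) (x := sigma t) y by exact: ZE.
have ys : a (ginv b) (sigma t) = p by rewrite -actM gmulV act1.
have E2 := @tangent_map_actK (ginv b) b (sigma t) p y (gmulgV _) ys.
apply: etrans (congr1 (fun v : E => to_coord c (x := sigma t) v) E2) _.
exact: of_coordK.
Qed.

Lemma covariant_derivative_sigma (a_homogeneous : homogeneous_space a p) :
  dpi a p X != 0 ->
  covariant_derivative (fun z => metric_coord F c z ^+ 2) (c \o sigma) T T t = 0 <->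
  forall Z, 'd (fun w : E => F p w ^+ 2 : R^o) (dpi a p X)
    (dpi a p (lie_bracket (G := G) X Z)) = 0.
Proof.
move=> dX0; have T0 := velocity_sigma_neq0 dX0.
have sL : smooth_at (energy F c) (c (sigma t), T t).
  by apply: smooth_at_energy => //; exact: source_target.
have gU := metric_mx_unit F ac sc T0.
have EL := geodesic_equation_euler_lagrange (@energy_homogeneous2 _ _ _ F c) (derive1 T t) (sL 3) gU.
have key Z : 'd (fun z => 'd (energy F c) z (0, 'd (xh Z) (t, 0) es1)) (c (sigma t), T t) (T t, derive1 T t)
  - 'd (energy F c) (c (sigma t), T t) ('d (xh Z) (t, 0) es1, 0) =
  - 'd (fun w : E => F p w ^+ 2 : R^o) (dpi a p X) (dpi a p (lie_bracket (G := G) X Z)).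
  have xt := nbhs_singleton (velocity_sigma Z).
  have xt0 : 'd (xh Z) (t, 0) et1 != 0 by rewrite -xt.
  have subst (z z' : E * E) (u u' v v' w : E) (K : R) : z = z' -> u = u' -> v = v' ->
      'd (fun z => 'd (energy F c) z (0, w)) z (u, v) - 'd (energy F c) z (w, 0) = K ->
      'd (fun z => 'd (energy F c) z (0, w)) z' (u', v') - 'd (energy F c) z' (w, 0) = K.
    by move=> -> -> ->.
  exact: subst (orbit_jetE Z) (esym xt) (esym (acceleration_sigma Z))
    (orbit_euler_lagrange expP ac (source_orbit_map Z) xt0 dX0).
apply: iff_trans EL _; split=> [EL0 Z|K0 w].
  have := etrans (esym (key Z)) (etrans (congr1 (fun r : R => r - _) (EL0 _)) (subrr _)).
  by move/eqP; rewrite oppr_eq0 => /eqP.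
have [Z ZE] := orbit_coord_surjective a_homogeneous w.
by have := key Z; rewrite K0 oppr0 ZE => /eqP; rewrite subr_eq0 => /eqP.
Qed.

(** The velocity vanishes on a neighbourhood of [t], hence so does the acceleration, and the Chern
    coefficients, whatever their default values at [y = 0], are multiplied by zero. *)
Lemma covariant_derivative_sigma0 : dpi a p X = 0 ->
  covariant_derivative (fun z => metric_coord F c z ^+ 2) (c \o sigma) T T t = 0.
Proof.
move=> dX0.
have ns : \forall s \near t, source c (sigma s).
  exact: near_source_comp (msmooth_sigma t).1 sc.
have T0 : \forall s \near t, T s = 0.
  apply: filterS2 ns (velocity_sigma 0) => s ss ->.
  apply: etrans (diff_orbit_coord 0 1 0 ac ss) _.
  have v0 : 1 *: dpi a p X + 0 *: dpi a p 0 = 0 by rewrite dX0 scale0r scaler0 addr0.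
  apply: etrans (congr1 (fun v : E => to_coord c (x := sigma s)
    (tangent_map (a (exp (s *: X))) (x := p) v)) v0) _.
  apply: etrans (congr1 (fun v : E => to_coord c (x := sigma s) v) _) (linear0 _).
  exact: linear0.
have dT0 : derive1 T t = 0.
  by rewrite derive1E (near_eq_derive _ T0) derive_cst.
have Tt0 k : T t 0 k = 0 by rewrite (nbhs_singleton T0) mxE.
apply/rowP => i; rewrite mxE [RHS]mxE dT0 [X in X + _]mxE add0r.
by rewrite big1 // => j _; rewrite big1 // => k _; rewrite !Tt0 mulr0.
Qed.

End AtChart.

(** The right side mentions neither [c] nor [t], so the equation at one time in one chart amounts to
    the equation everywhere. *)
Lemma covariant_derivative_sigma_iff (a_homogeneous : homogeneous_space a p) c t :
  atlas c -> source c (sigma t) ->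
  covariant_derivative (fun z => metric_coord F c z ^+ 2) (c \o sigma)
    (derive1 (c \o sigma)) (derive1 (c \o sigma)) t = 0 <->
  forall Z, fundamental_tensor F p (dpi a p X) (dpi a p X)
    (dpi a p (lie_bracket (G := G) X Z)) = 0.
Proof.
move=> ac sc; have [dX0|dX0] := eqVneq (dpi a p X) 0.
  split=> [_ Z|_]; last exact: covariant_derivative_sigma0.
  by rewrite dX0; exact: fundamental_tensor0.
apply: iff_trans (covariant_derivative_sigma ac sc a_homogeneous dX0) _.
split=> K0 Z.
  by rewrite fundamental_tensor_radial // K0 mulr0.
have := K0 Z; rewrite fundamental_tensor_radial // => /eqP.
by rewrite mulf_eq0 invr_eq0 pnatr_eq0 /= => /eqP.
Qed.

End GeodesicVectors.

Theorem theorem3p1 (R : realType) (d n : nat)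
    (M : manifold R n) (M_connected : connected [set: M]) (F : finsler M)
    (G : lie_group R d) (G_connected : connected [set: G])
    (a : isometric_action G F) (p : M) (a_homogeneous : homogeneous_space a p)
    (exp : lie_algebra G -> G) (expP : exponential_map exp)
    (m h : {vspace 'rV[R]_d}) (mh : reductive_decomposition a p exp m h)
    (X : 'rV[R]_d) (X_neq0 : X != 0) :
  geodesic_vector a p exp X <->
  forall Z : lie_algebra G,
    fundamental_tensor_m a p (daddv_pi m h X) (daddv_pi m h X)
      (daddv_pi m h (lie_bracket X Z)) = 0.
Proof.
have tensorE Z : fundamental_tensor_m a p (daddv_pi m h X) (daddv_pi m h X)
      (daddv_pi m h (lie_bracket (G := G) X Z)) =
    fundamental_tensor F p (dpi a p X) (dpi a p X) (dpi a p (lie_bracket (G := G) X Z)).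
  by rewrite /fundamental_tensor_m !(dpi_reductive expP _ mh).
split=> [[_ [_ geo]] Z|K0].
  rewrite tensorE.
  (* The geodesic equation is used at time 0 only, in the preferred chart at [p]. *)
  have p0 : a (exp (0 *: X)) p = p by rewrite (exp0 X expP) act1.
  have sc : source (chart_at p) (a (exp (0 *: X)) p).
    by rewrite p0; exact: chart_at_source.
  exact: (covariant_derivative_sigma_iff expP a_homogeneous (chart_at_atlas p) sc).1
    (geo _ (chart_at_atlas p) _ sc) Z.
split=> //; split.
  by apply: msmooth_curve => t; exact: msmooth_sigma.
move=> c ac t sc.
apply: (covariant_derivative_sigma_iff expP a_homogeneous ac sc).2 => Z.
by rewrite -tensorE.
Qed.
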